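(* For $j=7,10$ and every $n\ge 1$ the genus distribution of ${\cal S}_j^n$ is unimodal. Writing $p_j(n)$ for the peak of the genus distribution of ${\cal S}_j^n$, one has $$p_7(n)=\begin{cases}\Big[\dfrac{n}{2}\Big], & 2\le n\le 7,\\[2mm] 3, & n=8,\\[1mm] \Big[\dfrac{n+1}{3}\Big]+1, & n\ge 9,\end{cases}$$ and $$p_{10}(n)=\begin{cases}\Big[\dfrac{n+1}{2}\Big], & 1\le n\le 6,\\[2mm] 3, & n=7,\\[1mm] \Big[\dfrac{n+2}{3}\Big]+1, & n\ge 8.\end{cases}$$
   Context: $[x]$ denotes the largest integer not exceeding $x$. A surface is represented by a cyclic word in which every occurring letter $x$ appears exactly once as $x$ and exactly once as $x^-$; it is the closed orientable surface obtained from a polygon with boundary labelled by the word by identifying each side $x$ with the side $x^-$ (orientation reversed), and its genus is the genus of that surface. Let $a,b,a_1,a_2,\dots$ be distinct letters. For $n\ge 1$ and subsets $K,T\subseteq\{1,\dots,n\}$ put: $R_1^n$ = product of the letters $a_k$, $k\in K$, in decreasing order of index; $R_2^n$ = product of the $a_k$, $k\notin K$, in increasing order of index; $R_3^n$ = product of the $a_t^-$, $t\in T$, in decreasing order of index; $R_4^n$ = product of the $a_t^-$, $t\notin T$, in increasing order of index. The sets of ladder surfaces considered are ${\cal S}_7^n=\{aR_1^na^-R_3^nR_2^nR_4^n\}$ and ${\cal S}_{10}^n=\{R_1^nR_4^naR_2^na^-bR_3^nb^-\}$, where $(K,T)$ runs over all $4^n$ pairs of subsets and surfaces are counted with multiplicity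 (one for each pair). The genus distribution of ${\cal S}_j^n$ is the sequence $(g_{i_j}(n))_i$, where $g_{i_j}(n)$ is the number of surfaces of genus $i$ in ${\cal S}_j^n$ and $i$ runs from the minimum to the maximum genus. A finite sequence of nonnegative numbers $\{a_i\}_{i=q}^n$ is unimodal if $a_q\le\cdots\le a_{l-1}<a_l=\cdots=a_m>a_{m+1}\ge\cdots\ge a_n$ for some $q\le l\le m\le n$; if $l=m$, then $m$ is called the peak (indices are genera). *)

(* Defs.v *)
From HB Require Import structures.
From mathcomp Require Import all_boot all_order all_algebra ring.

Set Implicit Arguments.
Unset Strict Implicit.
Unset Printing Implicit Defensive.

Inductive letter := LetterA | LetterB | LetterAk of nat.

Definition letter_code (x : letter) : bool + nat :=
  match x with
  | LetterA => inl true
  | LetterB => inl false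
  | LetterAk k => inr k
  end.

Definition letter_decode (c : bool + nat) : letter :=
  match c with
  | inl true => LetterA
  | inl false => LetterB
  | inr k => LetterAk k
  end.

Lemma letter_codeK : cancel letter_code letter_decode.
Proof. by case. Qed.

HB.instance Definition _ := Equality.copy letter (can_type letter_codeK).

(* (x, false) stands for x and (x, true) for x^-. *)
Notation side := (letter * bool)%type.

Definition pos (x : letter) : side := (x, false).
Definition neg (x : letter) : side := (x, true).
Definition inv_side (s : side) : side := (s.1, ~~ s.2).

(* Every occurring letter x appears exactly once as x and once as x^-. *)
Definition surface_word (w : seq side) : bool :=
  uniq w && all (fun s => inv_side s \in w) w.

(* The corners of the polygon are the ordinals 'I_(size w): side i runs from
   corner i to the cyclically next corner ordS i. Gluing side i to the inverse
   side j with orientation reversed identifies the start of each of the two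
   sides with the end of the other. *)
Definition glued_corners (w : seq side) : rel 'I_(size w) :=
  fun c d =>
    [exists i : 'I_(size w), exists j : 'I_(size w),
      (tnth (in_tuple w) j == inv_side (tnth (in_tuple w) i)) &&
      ((c == i) && (d == ordS j) || (c == ordS i) && (d == j))].

(* Vertices of the glued surface: classes of corners under the equivalence
   relation generated by glued_corners, which is a symmetric relation. *)
Definition nb_vertices (w : seq side) : nat :=
  n_comp (@glued_corners w) 'I_(size w).

Definition nb_edges (w : seq side) : nat := (size w)./2.

Definition euler_char (w : seq side) : int :=
  ((nb_vertices w)%:Z - (nb_edges w)%:Z + 1)%R.

(* chi = 2 - 2g; only meaningful on nonempty words satisfying surface_word,
   where 2 - chi is even and nonnegative, so nothing is rounded. *)
Definition genus (w : seq side) : nat :=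
  `|((2%:Z - euler_char w)%R %/ 2)%Z|%N.

(* The index k in {1, ..., n} is represented by the ordinal of value k - 1;
   enum lists a set of ordinals in increasing order. *)
Definition idx (n : nat) (k : 'I_n) : letter := LetterAk k.+1.

Definition R1 (n : nat) (K : {set 'I_n}) : seq side :=
  [seq pos (idx k) | k <- rev (enum K)].
Definition R2 (n : nat) (K : {set 'I_n}) : seq side :=
  [seq pos (idx k) | k <- enum (~: K)].
Definition R3 (n : nat) (T : {set 'I_n}) : seq side :=
  [seq neg (idx t) | t <- rev (enum T)].
Definition R4 (n : nat) (T : {set 'I_n}) : seq side :=
  [seq neg (idx t) | t <- enum (~: T)].

(* A set of ladder surfaces with multiplicity: one word for each pair (K, T). *)
Definition ladder_family (n : nat) : Type :=
  {set 'I_n} * {set 'I_n} -> seq side.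

Definition S7 (n : nat) : ladder_family n := fun KT =>
  let: (K, T) := KT in
  [:: pos LetterA] ++ R1 K ++ [:: neg LetterA] ++ R3 T ++ R2 K ++ R4 T.

Definition S10 (n : nat) : ladder_family n := fun KT =>
  let: (K, T) := KT in
  R1 K ++ R4 T ++ [:: pos LetterA] ++ R2 K ++ [:: neg LetterA]
    ++ [:: pos LetterB] ++ R3 T ++ [:: neg LetterB].

Definition genus_dist (n : nat) (S : ladder_family n) (i : nat) : nat :=
  #|[set KT | genus (S KT) == i]|.

Definition min_genus (n : nat) (S : ladder_family n) : nat :=
  genus (S [arg min_(KT < (set0, set0)) genus (S KT)]).

Definition max_genus (n : nat) (S : ladder_family n) : nat :=
  genus (S [arg max_(KT > (set0, set0)) genus (S KT)]).

(* f q <= ... <= f (l-1) < f l = ... = f m > f (m+1) >= ... >= f r *)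
Definition unimodal_at (q r : nat) (f : nat -> nat) (l m : nat) : Prop :=
  q <= l <= m /\ m <= r /\
  (forall i, q <= i -> i.+1 < l -> f i <= f i.+1) /\
  (q < l -> f l.-1 < f l) /\
  (forall i, l <= i <= m -> f i = f l) /\
  (m < r -> f m.+1 < f m) /\
  (forall i, m < i -> i < r -> f i.+1 <= f i).

Definition unimodal (q r : nat) (f : nat -> nat) : Prop :=
  exists l m, unimodal_at q r f l m.

Definition is_peak (q r : nat) (f : nat -> nat) (p : nat) : Prop :=
  unimodal_at q r f p p.

Definition unimodal_genus_dist (n : nat) (S : ladder_family n) : Prop :=
  unimodal (min_genus S) (max_genus S) (genus_dist S).

Definition peak_genus_dist (n : nat) (S : ladder_family n) (p : nat) : Prop :=
  is_peak (min_genus S) (max_genus S) (genus_dist S) p.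

Lemma surface_word_perm (w v : seq side) :
  perm_eq w v -> surface_word w = surface_word v.
Proof.
move=> wv; rewrite /surface_word (perm_uniq wv) (perm_all _ wv).
by congr andb; apply: eq_all => s; rewrite (perm_mem wv).
Qed.

Lemma perm_setC (n : nat) (A : {set 'I_n}) (f : 'I_n -> side) :
  perm_eq ([seq f k | k <- rev (enum A)] ++ [seq f k | k <- enum (~: A)])
          [seq f k | k <- enum 'I_n].
Proof.
rewrite -map_cat; apply: perm_map; apply: uniq_perm.
- rewrite cat_uniq rev_uniq !enum_uniq andbT /=; apply/hasPn => k.
  by rewrite mem_rev !mem_enum inE.
- exact: enum_uniq.
- by move=> k; rewrite mem_cat mem_rev !mem_enum inE orbN.
Qed.

Lemma surface_word_letters (s : seq letter) :
  uniq s -> surface_word ([seq pos x | x <- s] ++ [seq neg x | x <- s]).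
Proof.
move=> us; apply/andP; split.
  rewrite cat_uniq !map_inj_uniq ?us /= ?andbT; try by move=> x y [].
  by apply/hasPn => _ /mapP[x _ ->]; apply/mapP => -[].
apply/allP => t; rewrite !mem_cat => /orP[] /mapP[x xs ->] /=.
  by rewrite [X in _ || X](map_f neg xs) orbT.
by rewrite [X in X || _](map_f pos xs).
Qed.

Lemma uniq_letters (n : nat) (s : seq letter) :
  uniq s -> all (fun x => if x is LetterAk _ then false else true) s ->
  uniq (s ++ [seq idx k | k <- enum 'I_n]).
Proof.
move=> us /allP sP; rewrite cat_uniq us map_inj_uniq ?enum_uniq ?andbT /=.
  by apply/hasPn => _ /mapP[k _ ->]; apply/negP => /sP.
by move=> x y [] /val_inj.
Qed.

Lemma surface_word_S7 (n : nat) (K T : {set 'I_n}) : surface_word (S7 (K, T)).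
Proof.
have := @surface_word_letters ([:: LetterA] ++ [seq idx k | k <- enum 'I_n]).
rewrite uniq_letters // => /(_ isT); apply: etrans; apply: surface_word_perm.
have /permP P := perm_setC K (fun k => pos (idx k)).
have /permP N := perm_setC T (fun k => neg (idx k)).
apply/permP => p; move: (P p) (N p).
rewrite !map_cat -!map_comp !count_cat /comp /= => <- <-; ring.
Qed.

Lemma surface_word_S10 (n : nat) (K T : {set 'I_n}) :
  surface_word (S10 (K, T)).
Proof.
have := @surface_word_letters
  ([:: LetterA; LetterB] ++ [seq idx k | k <- enum 'I_n]).
rewrite uniq_letters // => /(_ isT); apply: etrans; apply: surface_word_perm.
have /permP P := perm_setC K (fun k => pos (idx k)).
have /permP N := perm_setC T (fun k => neg (idx k)).
apply/permP => p; move: (P p) (N p).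
rewrite !map_cat -!map_comp !count_cat /comp /= => <- <-; ring.
Qed.

(* Main.v *)
From Stdlib Require Import ZArith Psatz.
Require Import Defs.
From mathcomp Require Import all_boot all_order all_algebra all_fingroup zify ring.

(* The vertices of a glued polygon are the cycles of the permutation sending a side to
   the successor of its inverse. The two sides of the letter a_k are inserted at two of
   four places of the word, the gates, whose position does not depend on k; this
   multiplies the vertex permutation by transpositions that only involve the gates and
   the two new sides. Hence it suffices to remember how the cycles traverse the gates,
   one of six permutations of four points for each family, and the number of pairs
   (K, T) of given genus is the number of walks in a finite automaton that count a given
   number of handles. With A_n(i) = C(n-i,i) + C(n-1-i,i), solving the recurrences gives
     g_i(n) = 2^(n+i-1) A_n(i-1) + 8^i A_n(i) - 8^(i-1) A_n(i-1)
   for the seventh family, and 4 g_i(n) = [the same for n+1] + 2[i=0] - 2[i=1] for the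
   tenth. The ratio A_n(i) / A_n(i-1) is a rational function of n and i that crosses
   1/2 at 3i = n + 2, up to rounding, and the last two terms are negligible there once
   n >= 22; smaller n are checked by computation. *)

Set Implicit Arguments.
Unset Strict Implicit.
Unset Printing Implicit Defensive.

(** * Cycle counts when points are joined to cycles or short-cut *)

Section Contraction.
Local Open Scope group_scope.
Variable T : finType.
Implicit Types (f s t : {perm T}) (x y z : T) (Y : seq T).

(** The orbit of the fixed point [x] is a singleton, so it differs from that of [y], and the
    transposition merges the two. *)
Lemma card_porbits_insert f x y :
  f x = x -> y != x -> #|porbits (tperm y x * f)|.+1 = #|porbits f|.
Proof.
move=> fx yx; have := porbits_mul_tperm f y x; rewrite yx.
have -> : y \notin porbit f x.
  apply/porbitP => -[i]; have -> : (f ^+ i) x = x.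
    by elim: i => [|i IHi]; rewrite ?perm1 // expgSr permM IHi.
  by move/eqP; rewrite (negPf yx).
by rewrite /= doubleS double0 addn2 addn1 => -[].
Qed.

(* [contract f x] short-cuts [x] in its cycle: [f^-1 x |-> f x] and [x |-> x]. *)
Definition contract f x : {perm T} := f * tperm x (f x).

Lemma contract_conj f s t x :
  s x = x -> t x = x -> contract (s * f * t) x = s * contract f x * t.
Proof.
move=> sx tx; rewrite /contract !permM sx -!mulgA; congr (_ * (_ * _)).
by rewrite [RHS]conjgC tpermJ tx.
Qed.

(** Contracting undoes an insertion: [f] is [tperm (f^-1 x) x] times the contraction, which fixes
    [x]. *)
Lemma card_porbits_contract f x :
  #|porbits (contract f x)| = #|porbits f| + (f x != x).
Proof.
rewrite /contract; case: eqP => [-> | /eqP fx]; first by rewrite tperm1 mulg1 addn0.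
set g := f * _; have gx : g x = x by rewrite permM tpermR.
have hx : f^-1 x != x by rewrite -(inj_eq (@perm_inj _ f)) permKV eq_sym.
rewrite addn1 -(card_porbits_insert gx hx); congr (#|porbits _|.+1).
have -> : g = tperm (f^-1 x) x * f by rewrite conjgC tpermJ permKV.
by rewrite mulgA tperm2 mul1g.
Qed.

Definition contracts f Y : {perm T} := foldl contract f Y.

(** Contraction at [y] changes the cycle count according to whether [y] is fixed, and multiplying by
    permutations that fix [y] does not alter that. Thus the sides inserted earlier can be ignored
    when a new rung is added. *)
Lemma contracts_conj f s t Y :
    {in Y, forall y, s y = y} -> {in Y, forall y, t y = y} ->
  contracts (s * f * t) Y = s * contracts f Y * t /\
  (#|porbits (s * f * t)| + #|porbits (contracts f Y)| =
    #|porbits (contracts (s * f * t) Y)| + #|porbits f|)%N.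
Proof.
elim: Y f => [|y Y IHY] f sY tY; first by rewrite addnC.
have sy : s y = y by rewrite sY ?mem_head.
have ty : t y = y by rewrite tY ?mem_head.
have [|z zY|E1 E2] := IHY (contract f y).
- by move=> z zY; rewrite sY // inE zY orbT.
- by rewrite tY // inE zY orbT.
rewrite /= contract_conj // E1; split=> //; move: E2; rewrite E1.
have := card_porbits_contract f y; have := card_porbits_contract (s * f * t) y.
have -> : ((s * f * t) y != y) = (f y != y).
  by rewrite !permM sy -{2}ty (inj_eq (@perm_inj _ t)).
rewrite contract_conj // => -> ->.
by rewrite addnAC [RHS]addnA => /addIn.
Qed.

End Contraction.

(* Lists of transpositions act from left to right on six points: 0, 1, 2, 3 are the gates
   of R1, R2, R3, R4 and 4, 5 the sides x, x^- of the letter being inserted. *)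
Definition swap (p : nat * nat) (i : nat) : nat :=
  if i == p.1 then p.2 else if i == p.2 then p.1 else i.

Definition swaps (l : seq (nat * nat)) (i : nat) : nat :=
  foldl (fun i p => swap p i) i l.

Definition in_range (l : seq (nat * nat)) : bool :=
  all (fun p => (p.1 < 6) && (p.2 < 6)) l.

(* Each transposition of a reduced list joins a fixed point [x] to another cycle. *)
Fixpoint reduced (l : seq (nat * nat)) : bool :=
  if l is (y, x) :: l' then [&& y != x, swaps l' x == x & reduced l'] else true.

(** From the top point downwards, the preimage [y] of [k] is split off by the transposition
    [(y, k)]; [find] returns [k] when there is no smaller preimage. The result depends only on the
    action of the list, so equal permutations become equal states. *)
Fixpoint normal_form (k : nat) (l : seq (nat * nat)) : seq (nat * nat) :=
  if k is k'.+1 then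
    let y := find (fun i => swaps l i == k) (iota 0 k) in
    if y == k then normal_form k' l else (y, k) :: normal_form k' ((y, k) :: l)
  else [::].

(** * The automaton of rung insertions *)

Definition state := seq (nat * nat).

(* R1 and R3 grow after their gates, by left multiplication; R2 and R4 grow before their
   gates, by right multiplication. The first component of a move tells whether x goes to
   R1 or R2, the second whether x^- goes to R3 or R4. *)
Definition pre_move (mv : bool * bool) : seq (nat * nat) :=
  (4, 5) :: nseq mv.1 (0, 4) ++ nseq mv.2 (2, 5).
Definition post_move (mv : bool * bool) : seq (nat * nat) :=
  nseq (~~ mv.1) (1, 4) ++ nseq (~~ mv.2) (3, 5).

(** The counterpart of [contract] on lists. *)
Definition bypass (i : nat) (l : seq (nat * nat)) : seq (nat * nat) :=
  rcons l (i, swaps l i).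

Definition moved (s : state) mv := pre_move mv ++ s ++ post_move mv.

Definition next_state (s : state) mv : state :=
  normal_form 3 (bypass 5 (bypass 4 (moved s mv))).

(* A move adds one edge and changes the number of vertices by 1 or by -1; in the latter
   case the genus increases. *)
Definition new_handle (s : state) mv : bool :=
  size s + 1 < size (next_state s mv) + (swaps (moved s mv) 4 != 4)
               + (swaps (bypass 4 (moved s mv)) 5 != 5).

(** The last equation says that a move lowers the cycle count by 1 or 3. The two new sides were
    fixed points before, so the vertices themselves change by 1 or -1. *)
Definition good_move (s : state) mv : bool :=
  let l1 := bypass 4 (moved s mv) in
  [&& in_range s, in_range (bypass 5 l1), in_range (next_state s mv),
      reduced s, reduced (next_state s mv),
      all (fun i => swaps (bypass 5 l1) i == swaps (next_state s mv) i) (iota 0 6)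
    & 1 + (new_handle s mv).*2 + size s ==
      size (next_state s mv) + (swaps (moved s mv) 4 != 4) + (swaps l1 5 != 5)].

Definition all_moves : seq (bool * bool) :=
  [:: (false, false); (false, true); (true, false); (true, true)].

(** The initial states are the vertex permutations, read on the gates, of the cyclic word
    [a a^- b b^-] without rungs: with both letters glued for the tenth family, with only [a] glued
    for the seventh. *)
Definition start10 : state := [:: (0, 3)].
Definition start7 : state := [:: (1, 3); (1, 2)].

Arguments next_state : simpl never.
Arguments new_handle : simpl never.

Inductive reachable : state -> Prop :=
| reachable10 : reachable start10
| reachable7 : reachable start7
| reachable_next s mv : reachable s -> reachable (next_state s mv).

Fixpoint orbit_states (d : nat) (ss : seq state) : seq state :=
  if d is d'.+1 then
    orbit_states d' (undup (ss ++ [seq next_state s mv | s <- ss, mv <- all_moves]))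
  else ss.

(** The depth 4 only has to be large enough for the list to be closed under moves, which is checked
    next. *)
Definition state_list : seq state := orbit_states 4 [:: start10; start7].

Lemma state_list_closed :
  all (fun s => all (fun mv => next_state s mv \in state_list) all_moves) state_list.
Proof. by vm_compute. Qed.

Lemma state_list_good :
  all (fun s => all (good_move s) all_moves
                && all (fun p => (p.1 < 4) && (p.2 < 4)) s) state_list.
Proof. by vm_compute. Qed.

Lemma mem_all_moves mv : mv \in all_moves.
Proof. by case: mv => [[] []]. Qed.

Lemma reachable_listed s : reachable s -> s \in state_list.
Proof.
elim=> [||{}s mv _ s_in]; [by vm_compute.. |].
exact: (allP (allP state_list_closed s s_in) mv (mem_all_moves mv)).
Qed.

Lemma reachable_good s mv : reachable s -> good_move s mv.
Proof.
move=> /reachable_listed s_in; have /andP[good _] := allP state_list_good s s_in.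
exact: (allP good mv (mem_all_moves mv)).
Qed.

Lemma reachable_gates s : reachable s -> all (fun p => (p.1 < 4) && (p.2 < 4)) s.
Proof.
by move=> /reachable_listed s_in; have /andP[_ gates] := allP state_list_good s s_in.
Qed.

(** * Lists of transpositions as permutations of sides *)

Section Realization.
Local Open Scope group_scope.
Variables (T : finType) (e : nat -> T).
Hypothesis e_inj : {in gtn 6 &, injective e}.

Definition swaps_perm (l : seq (nat * nat)) : {perm T} :=
  \prod_(p <- l) tperm (e p.1) (e p.2).

Lemma swaps_perm_cat l1 l2 :
  swaps_perm (l1 ++ l2) = swaps_perm l1 * swaps_perm l2.
Proof. exact: big_cat. Qed.

Lemma swaps_permE l i : in_range l -> i < 6 ->
  swaps_perm l (e i) = e (swaps l i) /\ swaps l i < 6.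
Proof.
rewrite /swaps_perm; elim: l i => [|[y x] l IHl] i /=; first by rewrite big_nil perm1.
move=> /andP[/andP[/= y6 x6] l6] i6; rewrite big_cons permM /=.
suff [-> s6] : tperm (e y) (e x) (e i) = e (swap (y, x) i) /\ swap (y, x) i < 6.
  exact: IHl l6 s6.
rewrite /swap /=; case: eqP => [->|/eqP iy]; first by rewrite tpermL.
case: eqP => [->|/eqP ix]; first by rewrite tpermR.
by rewrite tpermD // (inj_in_eq e_inj) // eq_sym.
Qed.

Lemma swaps_perm_out l z : in_range l -> (forall i, i < 6 -> z != e i) ->
  swaps_perm l z = z.
Proof.
move=> l6 ze; rewrite /swaps_perm; elim: l l6 => [|[y x] l IHl] /=.
  by rewrite big_nil perm1.
move=> /andP[/andP[/= y6 x6] l6]; rewrite big_cons permM tpermD ?IHl //=;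
  by rewrite eq_sym ze.
Qed.

Lemma eq_swaps_perm l l' : in_range l -> in_range l' ->
  all (fun i => swaps l i == swaps l' i) (iota 0 6) ->
  swaps_perm l = swaps_perm l'.
Proof.
move=> l6 l'6 /allP ll'; apply/permP => z.
have [[i i6 ->]|ze] : (exists2 i, i < 6 & z = e i) \/ (forall i, i < 6 -> z != e i).
  case: (boolP (has (fun i => z == e i) (iota 0 6))) => [/hasP[i]|/hasPn ze].
    by rewrite mem_iota => i6 /eqP ->; left; exists i.
  by right=> i i6; apply: ze; rewrite mem_iota.
- rewrite !(fst (swaps_permE _ _)) //; congr e; apply/eqP/ll'.
  by rewrite mem_iota.
- by rewrite !swaps_perm_out.
Qed.

Lemma card_porbits_reduced l : in_range l -> reduced l ->
  (#|porbits (swaps_perm l)| + size l)%N = #|T|.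
Proof.
elim: l => [_ _|[y x] l IHl /= /andP[/andP[/= y6 x6] l6] /and3P[yx /eqP lx rl]].
  rewrite /swaps_perm big_nil addn0 /porbits card_imset ?cardsT //.
  move=> u v /eqP; rewrite eq_porbit_mem => /porbitP[i].
  by rewrite expg1n perm1.
rewrite /swaps_perm big_cons addnS -addSn card_porbits_insert ?IHl //=.
  by rewrite -/(swaps_perm l) (fst (swaps_permE _ _)) // lx.
by rewrite (inj_in_eq e_inj).
Qed.

Lemma contract_swaps_perm l i : in_range l -> i < 6 ->
  contract (swaps_perm l) (e i) = swaps_perm (bypass i l).
Proof.
move=> l6 i6; rewrite /contract (fst (swaps_permE _ _)) //.
by rewrite /bypass -cats1 swaps_perm_cat {3}/swaps_perm big_seq1.
Qed.

(* The number of cycles changes as if the sides in [Y] had been removed. *)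
Lemma move_perm f Y s mv : reachable s ->
    {in Y, forall y, forall i, i < 6 -> y != e i} -> contracts f Y = swaps_perm s ->
  let f' := swaps_perm (pre_move mv) * f * swaps_perm (post_move mv) in
  contracts f' (Y ++ [:: e 4; e 5]) = swaps_perm (next_state s mv) /\
  (#|porbits f'| + (1 + (new_handle s mv).*2) = #|porbits f|)%N.
Proof.
move=> /(reachable_good mv)/and5P[s6 l26 t6 rs].
move=> /and3P[rt st /eqP cards] Ye fY f'.
have pre6 : in_range (pre_move mv) by case: (mv) => [[] []].
have post6 : in_range (post_move mv) by case: (mv) => [[] []].
have moved6 : in_range (moved s mv).
  by rewrite /in_range /moved catA all_cat all_cat [all _ s]s6 [all _ _]pre6.
have l16 : in_range (bypass 4 (moved s mv)).
  by move: l26; rewrite /in_range all_rcons => /andP[].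
have fixY l : in_range l -> {in Y, forall y, swaps_perm l y = y}.
  by move=> l6 y yY; apply: swaps_perm_out => // i i6; apply: Ye.
(* Both factors of the move fix [Y] pointwise, so contracting [Y] in the new permutation amounts to
   moving the state [s]. *)
have [E1 E2] := contracts_conj f (fixY _ pre6) (fixY _ post6).
move: E1 E2; rewrite fY -2!swaps_perm_cat -catA -/(moved s mv) -/f' => E1.
have E3 := card_porbits_contract (swaps_perm (moved s mv)) (e 4).
have E4 := card_porbits_contract (swaps_perm (bypass 4 (moved s mv))) (e 5).
rewrite contract_swaps_perm // (fst (swaps_permE _ _)) // (inj_in_eq e_inj) // in E3.
  rewrite contract_swaps_perm // (fst (swaps_permE _ _)) // (inj_in_eq e_inj) // in E4.
    have E5 := card_porbits_reduced s6 rs.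
    have E6 := card_porbits_reduced t6 rt.
    have E7 := eq_swaps_perm l26 t6 st.
    rewrite E1 => E2; split.
      by rewrite /contracts foldl_cat -/(contracts f' Y) E1 /= !contract_swaps_perm.
    move: cards E2 E3 E4 E5 E6; rewrite E7.
    set a := size s; set b := size _; set c := nat_of_bool _; set d := nat_of_bool _.
    clear; lia.
  by have [] := swaps_permE l16 (isT : 5 < 6).
by have [] := swaps_permE moved6 (isT : 4 < 6).
Qed.

End Realization.

(** * Cyclic successors and the vertices of a glued polygon *)

Section Next.
Variable T : finType.
Implicit Types (w : seq T) (p y z : T).

(** Deletion short-cuts [y] in the cyclic order, which is [contract] for the successor map. A
    rotation brings [y] to the front. *)
Lemma next_del w1 w2 y z : uniq (w1 ++ y :: w2) ->
  next (w1 ++ w2) z =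
    tperm y (next (w1 ++ y :: w2) y) (next (w1 ++ y :: w2) z).
Proof.
move=> Uw; have Uv : uniq (y :: w2 ++ w1) by rewrite -cat_cons uniq_catC.
have -> : next (w1 ++ w2) z = next (w2 ++ w1) z.
  by rewrite -(rot_size_cat w1 w2) next_rot // uniq_catC; case/andP: Uv.
have E u : next (w1 ++ y :: w2) u = next (y :: w2 ++ w1) u.
  by rewrite -cat_cons -(rot_size_cat w1 (y :: w2)) next_rot.
rewrite !{}E; move: (w2 ++ w1) Uv => v {w1 w2 Uw}.
case: v => [_|c v /= /and3P[yv cv Uv]] /=; first by rewrite eqxx tperm1 perm1; case: eqP.
rewrite eqxx; case: (eqVneq z y) => [->|zy].
  by rewrite tpermR -/(next (c :: v) y) next_nth (negPf yv).
(* The two traversals differ only in the wrap-around value, [c] or [y]. The side condition excludes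
   [z = c] past the head, so that a [z] that is not found is fixed by the transposition. *)
suff: forall u, y \notin u :: v -> (z == u) || (z != c) ->
    next_at z c u v = tperm y c (next_at z y u v) by apply=> //; case: (z == c).
move=> u; rewrite inE negb_or => /andP[yu {}yv].
elim: v cv u yu {Uv} yv => [|t v IHv] /= cv u yu yv zc.
  case: (z == u) zc => /= zc; first by rewrite tpermL.
  by rewrite tpermD // eq_sym.
move: cv yv; rewrite !inE !negb_or => /andP[ct cv] /andP[yt yv].
case: (z == u) zc => /= zc; first by rewrite tpermD // eq_sym.
by apply: IHv => //; rewrite zc orbT.
Qed.

Lemma next_insert_before w1 w2 p y z : uniq (w1 ++ y :: p :: w2) ->
  next (w1 ++ y :: p :: w2) z = tperm y p (next (w1 ++ p :: w2) z).
Proof.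
move=> Uw; have nyp : next (w1 ++ y :: p :: w2) y = p.
  by rewrite -(next_rot (size w1) Uw) rot_size_cat /= eqxx.
by rewrite (next_del z Uw) nyp tpermK.
Qed.

Lemma next_insert_after w1 w2 p y z : uniq (w1 ++ p :: y :: w2) ->
  next (w1 ++ p :: y :: w2) z = next (w1 ++ p :: w2) (tperm p y z).
Proof.
move=> Uw; set w := w1 ++ _.
have npy : next w p = y.
  by rewrite /w -(next_rot (size w1) Uw) rot_size_cat /= eqxx.
have Uw' : uniq (rcons w1 p ++ y :: w2) by rewrite cat_rcons.
have next_inj : injective (next w) by apply: (can_inj (prev_next Uw)).
rewrite -cat_rcons (next_del _ Uw') cat_rcons -/w.
case: (tpermP p y z) => [-> | -> | /eqP zp /eqP zy]; rewrite ?npy ?tpermL ?tpermR //.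
apply/esym/tpermD; last by rewrite (inj_eq next_inj) eq_sym.
by rewrite -[X in X != _]npy (inj_eq next_inj) eq_sym.
Qed.

Lemma nth_modn_next z0 w j : uniq w -> j < size w ->
  nth z0 w (j.+1 %% size w) = next w (nth z0 w j).
Proof.
move=> Uw jw; rewrite next_nth mem_nth // index_uniq //.
case: w jw {Uw} => //= y p; rewrite ltnS leq_eqVlt => /predU1P[->|jp].
  by rewrite modnn [RHS]nth_default.
by rewrite modn_small //=; apply: set_nth_default.
Qed.

Lemma card_porbits_fcard (f : {perm T}) : #|porbits f| = fcard f T.
Proof.
have symf : connect_sym (frel f) := fconnect_sym perm_inj.
have fcE x y : fconnect f x y = (y \in porbit f x).
  apply/idP/porbitP => [/iter_findex <-|[i ->]]; last by rewrite permX fconnect_iter.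
  by exists (findex f x y); rewrite permX.
rewrite /n_comp_mem -(card_in_imset (f := porbit f) (D := [predI froots f & T])).
  congr #|pred_of_set _|; apply/setP => o; apply/imsetP/imsetP => [] [x _ ->].
    exists (froot f x); first by rewrite !inE (roots_root symf).
    by apply/eqP; rewrite eq_porbit_mem porbit_sym -fcE connect_root.
  by exists x.
move=> x y /andP[/eqP <- _] /andP[/eqP <- _] /eqP.
by rewrite eq_porbit_mem porbit_sym -fcE => /(fingraph.rootP symf); rewrite !(root_root symf).
Qed.

Section Vertices.
Variables (h : T -> letter * bool) (bar : T -> T) (w : seq T).
Hypotheses (h_inj : injective h) (h_bar : forall z, h (bar z) = inv_side (h z)).
Hypotheses (Uw : uniq w) (bar_w : {in w, forall z, bar z \in w}).

Let start (i : 'I_(size (map h w))) : T := tnth (in_tuple w) (cast_ord (size_map h w) i).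

Let barK z : bar (bar z) = z.
Proof. by apply: h_inj; rewrite !h_bar /inv_side /= negbK; case: (h z). Qed.

Let start_inj : injective start.
Proof.
move=> i j; rewrite /start !(tnth_nth (start i)) /= => /eqP.
by rewrite nth_uniq ?size_map // -?(size_map h w) // => /eqP/val_inj.
Qed.

Let mem_start i : start i \in w.
Proof. exact: mem_tnth. Qed.

Let start_onto z : z \in w -> exists i, z = start i.
Proof.
move=> zw; have iz : index z w < size (map h w) by rewrite size_map index_mem.
by exists (Ordinal iz); rewrite /start (tnth_nth z) /= nth_index.
Qed.

Let h_start i : tnth (in_tuple (map h w)) i = h (start i).
Proof.
rewrite (tnth_nth (h (start i))) /= (nth_map (start i)) ?size_map //.
  by rewrite /start [in RHS](tnth_nth (start i)).
by rewrite -(size_map h).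
Qed.

Let start_ordS i : start (ordS i) = next w (start i).
Proof.
rewrite /start !(tnth_nth (start i)) -nth_modn_next //=; last by rewrite -(size_map h).
by congr nth; congr (_ %% _); apply: size_map.
Qed.

Variable f : {perm T}.
Hypothesis fE : {in w, forall z, f z = next w (bar z)}.

Let step z u := (f z == u) || (f u == z).

(** The start of [z] is glued to the end of [bar z], where the side [next w (bar z) = f z] starts;
    the second alternative of [glued_corners] is the same relation reversed. *)
Let glued_start c d : glued_corners c d = step (start c) (start d).
Proof.
apply/existsP/idP => [[i /existsP[j]]|].
  rewrite !h_start -h_bar (inj_eq h_inj) => /andP[/eqP ij].
  case/orP=> /andP[/eqP-> /eqP->]; rewrite /step start_ordS; apply/orP.
    by left; rewrite fE // -ij.
  by right; rewrite fE // ij barK.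
case/orP=> /eqP; rewrite fE // => E.
  have [j ji] := start_onto (bar_w (mem_start c)).
  exists c; apply/existsP; exists j; rewrite !h_start -h_bar ji !eqxx /=.
  by apply/orP; left; apply/eqP/start_inj; rewrite start_ordS -ji.
have [i id] := start_onto (bar_w (mem_start d)).
exists i; apply/existsP; exists d; rewrite !h_start -h_bar -id barK !eqxx /= andbT.
by apply/orP; right; apply/eqP/start_inj; rewrite start_ordS -id.
Qed.

Hypothesis f_out : forall z, z \notin w -> f z = z.

Let fw z : (f z \in w) = (z \in w).
Proof.
case: (boolP (z \in w)) => zw; last by rewrite f_out ?(negPf zw).
by rewrite fE // mem_next bar_w.
Qed.

Let connect_step : connect step =2 fconnect f.
Proof.
have symf : connect_sym (frel f) := fconnect_sym perm_inj.
move=> z u; apply/idP/idP; last first.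
  by apply: connect_sub => x y /= /eqP <-; apply: connect1; rewrite /step eqxx.
apply: connect_sub => x y /orP[] /eqP <-; last rewrite symf;
  by apply: connect1 => /=.
Qed.

(* Corners are represented by the sides starting at them; the sides of [T] not
   occurring in [w] are fixed by [f] and account for the second summand. *)
Lemma nb_vertices_porbits : nb_vertices (map h w) + (#|T| - size w) = #|porbits f|.
Proof.
have symf : connect_sym (frel f) := fconnect_sym perm_inj.
have syms : connect_sym step by move=> x y; rewrite !connect_step.
rewrite card_porbits_fcard (n_compC (mem w)) -(eq_n_comp connect_step).
congr (_ + _).
  have clw : closed step (mem w).
    by move=> x y /orP[] /eqP <-; rewrite /= fw.
  have symg : connect_sym (@glued_corners (map h w)).
    apply: sym_connect_sym => c d.
    by rewrite !glued_start /step orbC.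
  rewrite (adjunction_n_comp start syms symg clw).
    by apply: eq_n_comp_r => c; rewrite !inE mem_start.
  have gs : rel_base start step (@glued_corners (map h w)) [predC mem w].
    by move=> c d _; rewrite glued_start.
  apply: strict_adjunction gs => //.
  by apply/subsetP => z /start_onto[i ->]; apply: codom_f.
have <- : #|[predC w]| = #|T| - size w.
  by rewrite -(cardC (mem w)) (card_uniqP Uw) addKn.
rewrite /n_comp_mem; apply: eq_card => z; rewrite !inE.
case: (boolP (z \in w)) => zw; rewrite ?andbF //= andbT; symmetry.
apply/eqP; have /iter_findex <- := connect_root (frel f) z.
by elim: findex => //= k ->; rewrite f_out.
Qed.

End Vertices.
End Next.

(** * Ladder words built rung by rung *)

Fixpoint handles (s : state) (mvs : seq (bool * bool)) : nat :=
  if mvs is mv :: mvs' then new_handle s mv + handles (next_state s mv) mvs' else 0.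

Definition final_state : state -> seq (bool * bool) -> state := foldl next_state.

Lemma handles_rcons s mvs mv :
  handles s (rcons mvs mv) = handles s mvs + new_handle (final_state s mvs) mv.
Proof. by elim: mvs s => [|mv' mvs IH] s /=; rewrite ?addn0 // IH addnA. Qed.

Lemma final_state_reachable s mvs : reachable s -> reachable (final_state s mvs).
Proof. by elim: mvs s => // mv mvs IH s /(reachable_next mv)/IH. Qed.

Section Faces.
Variable n : nat.
Notation lside := ((bool + 'I_n) * bool)%type.
Implicit Types (z x y : lside) (k : 'I_n) (l : seq 'I_n) (s : seq lside).

Definition bar z : lside := (z.1, ~~ z.2).
Definition rung k : lside := (inr k, false).

Lemma barK : involutive bar.
Proof. by case=> c b; rewrite /bar /= negbK. Qed.

(* The letters of [P] are glued, the sides carrying other letters are left alone. *)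
Definition glue (P : pred (bool + 'I_n)) z : lside := if P z.1 then bar z else z.

Lemma glueK P : involutive (glue P).
Proof. by move=> z; rewrite /glue; case Pz: (P z.1); rewrite /= Pz ?barK. Qed.

Definition placed (P0 : pred bool) l : pred (bool + 'I_n) :=
  fun c => match c with inl c => P0 c | inr k => k \in l end.

Definition word4 := seq lside -> seq lside -> seq lside -> seq lside -> seq lside.

(* The four segments of a ladder word grow after [p1], before [i2], after [p3] and
   before [i4] respectively. *)
Definition gated (W : word4) p1 i2 p3 i4 : Prop := forall s1 s2 s3 s4 x,
  [/\ uniq (W (x :: s1) s2 s3 s4) -> uniq (W s1 s2 s3 s4) /\
        forall z, next (W (x :: s1) s2 s3 s4) z = next (W s1 s2 s3 s4) (tperm p1 x z),
      uniq (W s1 (rcons s2 x) s3 s4) -> uniq (W s1 s2 s3 s4) /\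
        forall z, next (W s1 (rcons s2 x) s3 s4) z = tperm i2 x (next (W s1 s2 s3 s4) z),
      uniq (W s1 s2 (x :: s3) s4) -> uniq (W s1 s2 s3 s4) /\
        forall z, next (W s1 s2 (x :: s3) s4) z = next (W s1 s2 s3 s4) (tperm p3 x z)
    & uniq (W s1 s2 s3 (rcons s4 x)) -> uniq (W s1 s2 s3 s4) /\
        forall z, next (W s1 s2 s3 (rcons s4 x)) z = tperm i4 x (next (W s1 s2 s3 s4) z)].

Variables (K T : {set 'I_n}) (W : word4) (P0 : pred bool) (o1 i2 o3 i4 : lside).
Hypothesis W_gated : gated W (bar o1) i2 (bar o3) i4.
Hypothesis gates_uniq : uniq [:: o1; i2; o3; i4].
Hypothesis gates_outer : all (fun z => if z.1 is inl _ then true else false) [:: o1; i2; o3; i4].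
Hypothesis o1_placed : if o1.1 is inl c then P0 c else false.
Hypothesis o3_placed : if o3.1 is inl c then P0 c else false.

Definition ladder_word l : seq lside :=
  W [seq rung k | k <- rev [seq k <- l | k \in K]]
    [seq rung k | k <- [seq k <- l | k \notin K]]
    [seq bar (rung k) | k <- rev [seq k <- l | k \in T]]
    [seq bar (rung k) | k <- [seq k <- l | k \notin T]].

Definition move_of k : bool * bool := (k \in K, k \in T).

(** Growth after a side acts before [next], and the glueing precedes it, so the gates [bar o1] and
    [bar o3] of the word appear here as [o1] and [o3]. Growth before a side acts after [next], and
    [i2], [i4] stay as they are. *)
Definition points k : nat -> lside := nth o1 [:: o1; i2; o3; i4; rung k; bar (rung k)].

Lemma points_inj k : {in gtn 6 &, injective (points k)}.
Proof.
move=> i j i6 j6 /eqP; rewrite /points nth_uniq //; first by move/eqP.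
rewrite -[[:: o1; i2; o3; i4; _; _]]/([:: o1; i2; o3; i4] ++ [:: rung k; bar (rung k)]).
rewrite cat_uniq gates_uniq andTb; apply/andP; split; last first.
  by rewrite /= inE andbT; apply/eqP => -[].
apply/hasPn => z zk; apply/negP => /(allP gates_outer).
by move: zk; rewrite !inE => /orP[] /eqP ->.
Qed.

(** The newest index comes first in the decreasing segments and last in the increasing ones, so both
    new sides land next to gates. [behead] drops the transposition [(4, 5)], which comes from
    glueing rather than from insertion. *)
Lemma ladder_word_rcons l k : uniq (ladder_word (rcons l k)) ->
  uniq (ladder_word l) /\
  forall z, next (ladder_word (rcons l k)) z =
    swaps_perm (points k) (post_move (move_of k))
      (next (ladder_word l)
        (swaps_perm (nth o1 [:: bar o1; i2; bar o3; i4; rung k; bar (rung k)])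
           (behead (pre_move (move_of k))) z)).
Proof.
rewrite /ladder_word /move_of !filter_rcons /swaps_perm.
set s1 := [seq rung k | k <- rev [seq k <- l | k \in K]].
set s2 := [seq rung k | k <- [seq k <- l | k \notin K]].
set s3 := [seq bar (rung k) | k <- rev [seq k <- l | k \in T]].
set s4 := [seq bar (rung k) | k <- [seq k <- l | k \notin T]].
case: (k \in K); case: (k \in T);
  rewrite /= ?rev_rcons ?map_rcons !(big_cons, big_nil) /points /= ?mulg1 -/s1 -/s2 -/s3 -/s4.
- move=> U; have [/(_ U) [U1 E1] _ _ _] := W_gated s1 s2 (bar (rung k) :: s3) s4 (rung k).
  have [_ _ /(_ U1) [V E2] _] := W_gated s1 s2 s3 s4 (bar (rung k)).
  by split=> // z; rewrite E1 E2 !permM perm1.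
- move=> U; have [/(_ U) [U1 E1] _ _ _] := W_gated s1 s2 s3 (rcons s4 (bar (rung k))) (rung k).
  have [_ _ _ /(_ U1) [V E2]] := W_gated s1 s2 s3 s4 (bar (rung k)).
  by split=> // z; rewrite E1 E2.
- move=> U; have [_ _ /(_ U) [U1 E1] _] := W_gated s1 (rcons s2 (rung k)) s3 s4 (bar (rung k)).
  have [_ /(_ U1) [V E2] _ _] := W_gated s1 s2 s3 s4 (rung k).
  by split=> // z; rewrite E1 E2.
- move=> U; have [_ _ _ /(_ U) [U1 E1]] := W_gated s1 (rcons s2 (rung k)) s3 s4 (bar (rung k)).
  have [_ /(_ U1) [V E2] _ _] := W_gated s1 s2 s3 s4 (rung k).
  by split=> // z; rewrite E1 E2 permM perm1.
Qed.

Lemma glue_tperm P x y z : glue P (tperm x y z) = tperm (glue P x) (glue P y) (glue P z).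
Proof. by rewrite (inj_tperm _ _ _ (can_inj (glueK P))). Qed.

(* The composition of the glueing with the cyclic successor in [ladder_word l] permutes
   the sides starting at the corners of each vertex cyclically. *)
Definition vertex_perm l (f : {perm lside}) : Prop :=
  forall z, f z = next (ladder_word l) (glue (placed P0 l) z).

(** Glueing the new letter contributes the transposition of its two sides; the insertions at
    [bar o1] and [bar o3] become transpositions at [o1] and [o3] when carried through the old
    glueing. *)
Lemma vertex_perm_rcons l k f : k \notin l -> uniq (ladder_word (rcons l k)) ->
  vertex_perm l f ->
  vertex_perm (rcons l k)
    (swaps_perm (points k) (pre_move (move_of k)) * f *
     swaps_perm (points k) (post_move (move_of k)))%g.
Proof.
move=> kl U fE z; have [_ ->] := ladder_word_rcons U; rewrite !permM fE.
congr (swaps_perm _ _ (next _ _)).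
have gx b : glue (placed P0 l) (inr k, b) = (inr k, b) by rewrite /glue /= (negPf kl).
have go1 : glue (placed P0 l) o1 = bar o1.
  by rewrite /glue; case: (o1) o1_placed => [[c|j] b] //= ->.
have go3 : glue (placed P0 l) o3 = bar o3.
  by rewrite /glue; case: (o3) o3_placed => [[c|j] b] //= ->.
have -> : glue (placed P0 (rcons l k)) z =
          glue (placed P0 l) (tperm (rung k) (bar (rung k)) z).
  rewrite glue_tperm !gx /glue; case: z => [[c|j] b] /=.
    by rewrite tpermD //; case: (P0 c); apply/eqP => -[].
  rewrite mem_rcons inE; case: (eqVneq j k) => [->|jk] /=.
    by rewrite (negPf kl); case: b; rewrite ?tpermL ?tpermR.
  by rewrite tpermD //; case: (_ \in l); apply/eqP => -[/esym/eqP]; rewrite (negPf jk).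
rewrite /pre_move /swaps_perm big_cons permM /points /=.
move: (tperm _ _ z) => {}z; case: (k \in K); case: (k \in T) => /=;
  by rewrite !(big_cons, big_nil) /= ?mulg1 ?permM ?perm1 // !glue_tperm !gx ?go1 ?go3.
Qed.

Variable s0 : state.
Hypothesis s0_reachable : reachable s0.
Let gate := nth o1 [:: o1; i2; o3; i4].

Let gateE k t : reachable t -> swaps_perm (points k) t = swaps_perm gate t.
Proof.
move=> /reachable_gates/allP t4; apply: eq_big_seq => -[i j] /t4 /andP[/= i4' j4'].
by congr tperm; rewrite /points /gate; case: i i4' j j4' => [|[|[|[|i]]]] //= _ [|[|[|[|j]]]].
Qed.

Lemma card_porbits_gate : 0 < n ->
  #|porbits (swaps_perm gate s0)| + size s0 = #|{: lside}|.
Proof.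
move=> n0; rewrite -(gateE (Ordinal n0)) //.
have /and5P[s6 _ _ rs _] := reachable_good (false, false) s0_reachable.
by rewrite (card_porbits_reduced (@points_inj (Ordinal n0)) s6 rs).
Qed.

Hypothesis vertex_perm0 : vertex_perm [::] (swaps_perm gate s0).

Lemma vertex_permP l : uniq l -> uniq (ladder_word l) ->
  exists2 f, vertex_perm l f &
    #|porbits f| + size l + (handles s0 (map move_of l)).*2 =
    #|porbits (swaps_perm gate s0)|.
Proof.
(* The induction also carries the sides [Y] inserted so far; contracting them leaves the current
   state on the gates, as [move_perm] requires. *)
move=> Ul UW; suff [f [Y [fl _ _ Nf]]] : exists f Y, [/\ vertex_perm l f,
    {in Y, forall y, exists2 k, k \in l & y.1 = inr k},
    contracts f Y = swaps_perm gate (final_state s0 (map move_of l)) &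
    #|porbits f| + size l + (handles s0 (map move_of l)).*2 =
    #|porbits (swaps_perm gate s0)|] by exists f.
elim/last_ind: l Ul UW => [|l k IHl].
  by exists (swaps_perm gate s0), [::]; rewrite !addn0.
rewrite rcons_uniq => /andP[kl Ul] UW.
have [|f [Y [fl Yl fY Nf]]] := IHl Ul; first by case: (ladder_word_rcons UW).
have s_reach := final_state_reachable (map move_of l) s0_reachable.
move: fY Nf; set s := final_state _ _ in s_reach * => fY Nf.
have [|| fY' Nf'] := @move_perm _ _ (@points_inj k) f Y s (move_of k) s_reach.
- move=> y /Yl [j jl yj] i i6; apply: contraNneq kl => yi.
  have: (y.1 == inr k) || (if y.1 is inl _ then true else false).
    rewrite yi; case: i i6 {yi} => [|[|[|[|[|[|]]]]]] //= _;
      by rewrite ?eqxx // (allP gates_outer) ?orbT // !inE eqxx ?orbT.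
  by rewrite yj orbF => /eqP [<-].
- by rewrite fY (gateE k).
exists (swaps_perm (points k) (pre_move (move_of k)) * f *
  swaps_perm (points k) (post_move (move_of k)))%g, (Y ++ [:: rung k; bar (rung k)]).
split.
- exact: vertex_perm_rcons.
- move=> y; rewrite mem_cat => /orP[/Yl[j jl ->]|].
    by exists j; rewrite // mem_rcons inE jl orbT.
  by rewrite !inE => /orP[] /eqP ->; exists k; rewrite // mem_rcons mem_head.
- rewrite map_rcons /final_state foldl_rcons -/(final_state _ _) -/s.
  by rewrite -(gateE k) ?fY' //; apply: reachable_next.
- rewrite size_rcons map_rcons handles_rcons -/s -Nf -Nf'.
  move: #|_| (nat_of_bool _) (handles _ _) => N b h; clear; lia.
Qed.

End Faces.

Lemma uniq_del (T : eqType) (w1 w2 : seq T) y : uniq (w1 ++ y :: w2) -> uniq (w1 ++ w2).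
Proof. by rewrite uniq_catC /= => /andP[_]; rewrite uniq_catC. Qed.

(** * The words of the two families and their genera *)

Section Words.
Variable n : nat.
Notation lside := ((bool + 'I_n) * bool)%type.

Lemma grow_after (w1 w2 : seq lside) p x : uniq (w1 ++ p :: x :: w2) ->
  uniq (w1 ++ p :: w2) /\
  forall z, next (w1 ++ p :: x :: w2) z = next (w1 ++ p :: w2) (tperm p x z).
Proof.
move=> U; split=> [|z]; last exact: next_insert_after.
by move: U; rewrite -!(cat_rcons p); apply: uniq_del.
Qed.

Lemma grow_before (w1 w2 : seq lside) p x : uniq (w1 ++ x :: p :: w2) ->
  uniq (w1 ++ p :: w2) /\
  forall z, next (w1 ++ x :: p :: w2) z = tperm p x (next (w1 ++ p :: w2) z).
Proof.
move=> U; split=> [|z]; last by rewrite tpermC next_insert_before.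
exact: uniq_del U.
Qed.

Definition sideA : lside := (inl true, false).
Definition sideB : lside := (inl false, false).

Definition word10 : word4 n := fun s1 s2 s3 s4 =>
  s1 ++ s4 ++ sideA :: s2 ++ bar sideA :: sideB :: s3 ++ [:: bar sideB].

(* The words of the seventh family, with two unglued sides that mark the ends of the
   last two segments. *)
Definition word7 : word4 n := fun s1 s2 s3 s4 =>
  sideA :: s1 ++ bar sideA :: s3 ++ s2 ++ sideB :: s4 ++ [:: bar sideB].

Lemma gated_word10 : gated word10 (bar sideB) (bar sideA) sideB sideA.
Proof.
move=> s1 s2 s3 s4 x; rewrite /word10; split.
(* The first segment opens the word, so its gate is the last side; a rotation by one makes the two
   adjacent. *)
- rewrite cat_cons; set v := s4 ++ _; have [v' ->] : exists v', s1 ++ v = rcons v' (bar sideB).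
    exists (s1 ++ s4 ++ sideA :: s2 ++ bar sideA :: sideB :: s3).
    by rewrite /v -cats1 -!catA /= -!catA.
  have rotE : rot 1 (x :: rcons v' (bar sideB)) = v' ++ [:: bar sideB; x].
    by rewrite rot1_cons -!cats1 -catA.
  move=> U; have [] := @grow_after v' [::] (bar sideB) x.
    by rewrite -rotE rot_uniq.
  rewrite cats1 => U' E; split=> // z.
  by rewrite -E -rotE next_rot.
- have := @grow_before (s1 ++ s4 ++ sideA :: s2) (sideB :: s3 ++ [:: bar sideB]) (bar sideA) x.
  by rewrite cat_rcons -!catA.
- have := @grow_after (s1 ++ s4 ++ sideA :: s2 ++ [:: bar sideA]) (s3 ++ [:: bar sideB]) sideB x.
  by rewrite -!catA /= -!catA.
- have := @grow_before (s1 ++ s4) (s2 ++ bar sideA :: sideB :: s3 ++ [:: bar sideB]) sideA x.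
  by rewrite cat_rcons -!catA.
Qed.

Lemma gated_word7 : gated word7 sideA sideB (bar sideA) (bar sideB).
Proof.
move=> s1 s2 s3 s4 x; rewrite /word7; split.
- exact: (@grow_after [::]).
- have := @grow_before (sideA :: s1 ++ bar sideA :: s3 ++ s2) (s4 ++ [:: bar sideB]) sideB x.
  by rewrite cat_rcons /= -!catA /= -!catA.
- have := @grow_after (sideA :: s1) (s3 ++ s2 ++ sideB :: s4 ++ [:: bar sideB]) (bar sideA) x.
  by [].
- have := @grow_before (sideA :: s1 ++ bar sideA :: s3 ++ s2 ++ sideB :: s4) [::] (bar sideB) x.
  by rewrite cat_rcons /= -!catA /= -!catA.
Qed.

Definition to_side (z : lside) : letter * bool :=
  (match z.1 with inl c => letter_decode (inl c) | inr k => idx k end, z.2).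

Lemma to_side_inj : injective to_side.
Proof.
by move=> [[[]|k] c] [[[]|j] d] // [] // => [->|->|/val_inj -> ->].
Qed.

Lemma to_side_bar z : to_side (bar z) = inv_side (to_side z).
Proof. by case: z. Qed.

Lemma card_lside : #|{: lside}| = n.*2 + 4.
Proof. by rewrite card_prod card_sum card_bool card_ord mulnC; lia. Qed.

Lemma genusE w h : nb_vertices w + h.*2 = nb_edges w + 1 -> genus w = h.
Proof.
rewrite /genus /euler_char => E.
have -> : (2%:Z - ((nb_vertices w)%:Z - (nb_edges w)%:Z + 1))%R = (h%:Z * 2)%R by lia.
by rewrite intdiv.mulzK.
Qed.

Lemma filter_enum (A : {set 'I_n}) : [seq k <- enum 'I_n | k \in A] = enum A.
Proof. by rewrite [RHS]/enum_mem -enumT. Qed.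

Section Genus.
Variables K T : {set 'I_n}.

Definition moves : seq (bool * bool) := [seq (k \in K, k \in T) | k <- enum 'I_n].

Lemma map_word10 : map to_side (ladder_word K T word10 (enum 'I_n)) = S10 (K, T).
Proof.
rewrite /ladder_word /word10 /S10 /R1 /R2 /R3 /R4.
rewrite -!filter_enum !map_cat /= !map_cat /= !map_cat /= -!map_comp.
by do !congr (_ ++ _); (do ?congr (_ :: _)); do ?congr (_ ++ _);
  congr map; try apply: eq_filter => k; rewrite ?inE.
Qed.

Lemma next_neq (w : seq lside) y : uniq w -> y \in w -> 1 < size w -> next w y != y.
Proof.
move=> U yw w1; have [i s E] := rot_to yw.
have Us : uniq (y :: s) by rewrite -E rot_uniq.
have : 1 < size (y :: s) by rewrite -E size_rot.
rewrite -(next_rot i U) E; case: s Us {E} => //= c s; rewrite eqxx inE.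
by case/andP; rewrite negb_or eq_sym => /andP[].
Qed.

Lemma size_ladder_word (W : word4 n) c l :
    (forall s1 s2 s3 s4, size (W s1 s2 s3 s4) = size s1 + size s2 + size s3 + size s4 + c) ->
  size (ladder_word K T W l) = (size l).*2 + c.
Proof.
move=> ->; rewrite !size_map !size_rev !size_filter.
have E (A : {set 'I_n}) : count (fun k => k \in A) l + count (fun k => k \notin A) l = size l.
  exact: count_predC.
by rewrite -addnn -{1}(E K) -(E T) !addnA.
Qed.

Lemma full_word (w : seq lside) : uniq w -> size w = n.*2 + 4 -> forall z, z \in w.
Proof.
move=> Uw sw z; have /subset_leqif_card[_] : w \subset {: lside} by apply/subsetP.
rewrite (card_uniqP Uw) sw card_lside eqxx => /esym/subsetP; exact.
Qed.

Lemma uniq_word10 : uniq (ladder_word K T word10 (enum 'I_n)).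
Proof.
by have /andP[] := surface_word_S10 K T; rewrite -map_word10 => /map_uniq.
Qed.

(** The word uses every element of the type of sides, so the vertices are exactly the cycles of
    [f]. *)
Theorem genus_S10 : 0 < n -> genus (S10 (K, T)) = handles start10 moves.
Proof.
move=> n0; apply: genusE; rewrite -map_word10; set w := ladder_word _ _ _ _.
have o1g : all (fun z => if z.1 is inl _ then true else false)
  [:: sideB; bar sideA; bar sideB; sideA] by [].
have f0 : vertex_perm K T word10 xpredT [::]
    (swaps_perm (nth sideB [:: sideB; bar sideA; bar sideB; sideA]) start10).
  move=> z; rewrite /swaps_perm big_seq1 /ladder_word /word10 /=.
  by case: z => [[[]|k] []]; rewrite ?tpermL ?tpermR ?tpermD.
have sw : size w = n.*2 + 4.
  rewrite /w (size_ladder_word (c := 4)) ?size_enum_ord // => s1 s2 s3 s4.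
  rewrite !(size_cat, size_rcons) /= !(size_cat, size_rcons) /= !(size_cat, size_rcons) /=.
  lia.
have [f fE] := @vertex_permP n K T word10 xpredT sideB (bar sideA) (bar sideB) sideA
  gated_word10 isT o1g isT isT start10 reachable10 f0 (enum 'I_n) (enum_uniq _) uniq_word10.
have := @card_porbits_gate n sideB (bar sideA) (bar sideB) sideA isT o1g _ reachable10 n0.
rewrite size_enum_ord -/moves ![size _]/= => N0 Nf.
have Uw := uniq_word10; have w_all := full_word Uw sw.
have := @nb_vertices_porbits _ to_side (@bar n) w to_side_inj to_side_bar Uw _ f _ _.
rewrite card_lside sw subnn addn0 => ->.
- rewrite /nb_edges size_map sw; move: N0 Nf; rewrite card_lside.
  move: #|_| #|_| (handles _ _) => N N' h; lia.
- by move=> z _; apply: w_all.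
- by move=> z _; rewrite fE /glue; case: z => [[c|k] d] //=; rewrite mem_enum.
- by move=> z; rewrite w_all.
Qed.

Definition unmarked7 : word4 n := fun s1 s2 s3 s4 =>
  sideA :: s1 ++ bar sideA :: s3 ++ s2 ++ s4.

Lemma map_unmarked7 : map to_side (ladder_word K T unmarked7 (enum 'I_n)) = S7 (K, T).
Proof.
rewrite /ladder_word /unmarked7 /S7 /R1 /R2 /R3 /R4.
rewrite -!filter_enum /= !map_cat /= !map_cat /= -!map_comp.
congr (_ :: _); do !congr (_ ++ _); (do ?congr (_ :: _)); do ?congr (_ ++ _);
  congr map; try apply: eq_filter => k; by rewrite ?inE.
Qed.

Lemma uniq_unmarked7 : uniq (ladder_word K T unmarked7 (enum 'I_n)).
Proof.
by have /andP[] := surface_word_S7 K T; rewrite -map_unmarked7 => /map_uniq.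
Qed.

Lemma mem_unmarked7 z : z \in ladder_word K T unmarked7 (enum 'I_n) -> z.1 != inl false.
Proof.
rewrite /ladder_word /unmarked7 !(inE, mem_cat).
by do ![case/orP]; try (by move/eqP ->); case/mapP => k _ ->.
Qed.

Lemma uniq_word7 : uniq (ladder_word K T word7 (enum 'I_n)).
Proof.
have U : uniq (sideB :: bar sideB :: ladder_word K T unmarked7 (enum 'I_n)).
  rewrite cons_uniq cons_uniq uniq_unmarked7 andbT inE negb_or.
  by apply/andP; split; [apply/andP; split=> // |]; apply/negP => /mem_unmarked7.
apply: etrans U; apply: perm_uniq; apply/seq.permP => p.
rewrite /ladder_word /word7 /unmarked7 /= !count_cat /= !count_cat /= count_cat /=; ring.
Qed.

(** The two unglued markers are removed by contraction. Each removal creates one cycle, and these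
    two cycles are the fixed points outside the actual word that [nb_vertices_porbits] accounts
    for. *)
Theorem genus_S7 : 0 < n -> genus (S7 (K, T)) = handles start7 moves.
Proof.
move=> n0; apply: genusE; rewrite -map_unmarked7; set w := ladder_word _ _ _ _.
have o1g : all (fun z => if z.1 is inl _ then true else false)
  [:: bar sideA; sideB; sideA; bar sideB] by [].
have f0 : vertex_perm K T word7 id [::]
    (swaps_perm (nth (bar sideA) [:: bar sideA; sideB; sideA; bar sideB]) start7).
  move=> z; rewrite /swaps_perm big_cons big_seq1 /ladder_word /word7 /= permM.
  by case: z => [[[]|k] []]; rewrite !permE /= ?permE.

have sw : size w = n.*2 + 2.
  rewrite /w (size_ladder_word (c := 2)) ?size_enum_ord // => s1 s2 s3 s4.
  rewrite /= !size_cat /= !size_cat; lia.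
have [f fE] := @vertex_permP n K T word7 id (bar sideA) sideB sideA (bar sideB)
  gated_word7 isT o1g isT isT start7 reachable7 f0 (enum 'I_n) (enum_uniq _) uniq_word7.
have := @card_porbits_gate n (bar sideA) sideB sideA (bar sideB) isT o1g _ reachable7 n0.
rewrite size_enum_ord -/moves ![size _]/= => N0 Nf.
rewrite /vertex_perm in fE.
set w2 := ladder_word K T word7 (enum 'I_n) in fE; have Uw2 : uniq w2 := uniq_word7.
have sw2 : size w2 = n.*2 + 4.
  rewrite /w2 (size_ladder_word (c := 4)) ?size_enum_ord // => s1 s2 s3 s4.
  rewrite /= !size_cat /= !size_cat /= size_cat /=; lia.
pose glued := glue (placed id (enum 'I_n)).
have delete y u1 u2 (g : {perm lside}) : glued y = y ->
    uniq (u1 ++ y :: u2) -> 1 < size (u1 ++ y :: u2) ->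
    (forall z, g z = next (u1 ++ y :: u2) (glued z)) ->
  (forall z, contract g y z = next (u1 ++ u2) (glued z)) /\
  #|porbits (contract g y)| = #|porbits g|.+1.
  move=> gy U s1 gE; split=> [z|].
    by rewrite (next_del _ U) permM -gE -[X in next _ X]gy -gE.
  rewrite card_porbits_contract gE gy next_neq ?addn1 // mem_cat mem_head orbT //.
pose r1 := [seq rung k | k <- rev [seq k <- enum 'I_n | k \in K]].
pose r2 := [seq rung k | k <- [seq k <- enum 'I_n | k \notin K]].
pose r3 := [seq bar (rung k) | k <- rev [seq k <- enum 'I_n | k \in T]].
pose r4 := [seq bar (rung k) | k <- [seq k <- enum 'I_n | k \notin T]].
have w2E : w2 = (sideA :: r1 ++ bar sideA :: r3 ++ r2 ++ sideB :: r4) ++ [:: bar sideB].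
  by rewrite /= -!catA /= -!catA.
rewrite w2E in fE Uw2 sw2.
have [||fE1 Nf1] := delete _ _ _ f _ Uw2 _ fE; [by [] | by rewrite sw2 !addnS |].
rewrite cats0 in fE1.
have w1E : sideA :: r1 ++ bar sideA :: r3 ++ r2 ++ sideB :: r4 =
    (sideA :: r1 ++ bar sideA :: r3 ++ r2) ++ sideB :: r4.
  by rewrite /= -!catA /= -!catA.
rewrite w1E in fE1.
have Uw1 : uniq ((sideA :: r1 ++ bar sideA :: r3 ++ r2) ++ sideB :: r4).
  by move: Uw2; rewrite w1E cat_uniq => /andP[].
have [||fE2 Nf2] := delete _ _ _ _ _ Uw1 _ fE1; first by [].
  by rewrite /= size_cat /= addnS.
have wE : (sideA :: r1 ++ bar sideA :: r3 ++ r2) ++ r4 = w by rewrite /= -!catA /= -!catA.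
rewrite wE in fE2.
set g := contract _ _ in fE2 Nf2.
have Uw : uniq w := uniq_unmarked7.
have mw z : (z \in w) = (z.1 != inl false).
  apply/idP/idP => [/mem_unmarked7 //|zB].
  have: z \in w2 by apply: full_word; rewrite w2E.
  rewrite w2E -wE w1E !mem_cat !inE.
  by case: z zB => [[[]|k] []] //=; rewrite ?orbT // !orbF.
have := @nb_vertices_porbits _ to_side (@bar n) w to_side_inj to_side_bar Uw _ g _ _.
rewrite card_lside sw subnDl => V.
have {V} : nb_vertices (map to_side w) + 2 = #|porbits g|.
  apply: V => z.
  - by rewrite !mw.
  - by rewrite mw fE2 /glued /glue; case: z => [[[]|k] d] //= _; rewrite mem_enum.
  - rewrite mw negbK => /eqP zB; rewrite fE2 /glued /glue zB.
    by rewrite next_nth mw zB.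
rewrite Nf2 Nf1 /nb_edges size_map sw; move: N0 Nf; rewrite card_lside.
move: #|_| #|_| (handles _ _) (nb_vertices _) => N N' h V; lia.
Qed.

End Genus.

End Words.

(** * Counting pairs of subsets by walks in the automaton *)

Definition shift (R : Type) (zero : R) (f : nat -> R) (i : nat) : R :=
  if i is i'.+1 then f i' else zero.

(** For generating functions in the genus, a new handle is multiplication by the variable, which is
    [shift]. *)
Fixpoint count_moves (s : state) (n : nat) : nat -> nat :=
  if n is n'.+1 then fun i =>
    \sum_(mv : bool * bool)
      (if new_handle s mv then shift 0 (count_moves (next_state s mv) n') i
       else count_moves (next_state s mv) n' i)
  else fun i => i == 0.

Lemma count_movesE s n i :
  #|[set t : n.-tuple (bool * bool) | handles s t == i]| = count_moves s n i.
Proof.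
rewrite -sum1dep_card big_mkcond /=.
elim: n s i => [|n IHn] s i /=.
  rewrite (big_pred1 [tuple]) => [|t]; last by rewrite [t]tuple0 /= eqxx.
  by case: i.
rewrite (reindex (fun p : (bool * bool) * n.-tuple (bool * bool) => [tuple of p.1 :: p.2])) /=.
  rewrite -(pair_bigA _ (fun mv (t : n.-tuple (bool * bool)) =>
    if new_handle s mv + handles (next_state s mv) t == i then 1 else 0)) /=.
  apply: eq_bigr => mv _; case: (new_handle s mv); last by rewrite -IHn.
  by case: i => [|i] /=; [rewrite big1 | rewrite -IHn; apply: eq_bigr].
exists (fun t => (thead t, [tuple of behead t])) => [[mv t] _|t _] /=.
  by rewrite theadE; congr (_, _); apply: val_inj.
by rewrite [RHS]tuple_eta.
Qed.

Lemma card_moves n s i :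
  #|[set KT : {set 'I_n} * {set 'I_n} | handles s (moves KT.1 KT.2) == i]| =
  count_moves s n i.
Proof.
rewrite -count_movesE.
pose tup (KT : {set 'I_n} * {set 'I_n}) : n.-tuple (bool * bool) :=
  [tuple (k \in KT.1, k \in KT.2) | k < n].
have tupE KT : tup KT = moves KT.1 KT.2 :> seq _ by [].
have tup_bij : bijective tup.
  exists (fun t => ([set k | (tnth t k).1], [set k | (tnth t k).2])) => [[K T]|t].
    by congr (_, _); apply/setP => k; rewrite inE tnth_mktuple.
  by apply: eq_from_tnth => k; rewrite tnth_mktuple !inE; case: (tnth t k).
rewrite -(on_card_preimset (onW_bij _ tup_bij)); apply: eq_card => KT.
by rewrite !inE -tupE.
Qed.

Lemma genus_dist_S10 n i : 0 < n -> genus_dist (@S10 n) i = count_moves start10 n i.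
Proof.
move=> n0; rewrite -card_moves; apply: eq_card => -[K T].
by rewrite !inE genus_S10.
Qed.

Lemma genus_dist_S7 n i : 0 < n -> genus_dist (@S7 n) i = count_moves start7 n i.
Proof.
move=> n0; rewrite -card_moves; apply: eq_card => -[K T].
by rewrite !inE genus_S7.
Qed.

(** Passing the successors as an explicit list lets each transition be verified by evaluation. *)
Lemma count_movesS s n i (l : seq (state * bool)) :
    [seq (next_state s mv, new_handle s mv) | mv <- all_moves] = l ->
  count_moves s n.+1 i =
  \sum_(p <- l) (if p.2 then shift 0 (count_moves p.1 n) i else count_moves p.1 n i).
Proof.
move=> <-; rewrite big_map /= [LHS](bigID (fun mv => mv \in all_moves)) /=.
rewrite [X in _ + X]big1 ?addn0 => [|mv]; last by rewrite mem_all_moves.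
by rewrite -big_uniq.
Qed.

(** * Closed forms for the recurrences *)

Local Open Scope Z_scope.
Arguments Z.mul : simpl never.
Arguments Z.add : simpl never.
Arguments Z.sub : simpl never.

(* The coefficients 'C(n - i, i) + 'C(n - 1 - i, i) of the Lucas polynomials, except that
   [lucas 0 0] is 1. *)
Fixpoint lucas (n i : nat) : Z :=
  match n with
  | 0%N => if i is 0%N then 1 else 0
  | 1%N => if i is 0%N then 2 else 0
  | (n'.+1 as n1).+1 => lucas n1 i + shift 0 (lucas n') i
  end.

Definition pow2 (n : nat) : Z := Z.pow 2 (Z.of_nat n).
Definition pow8 (n : nat) : Z := Z.pow 8 (Z.of_nat n).

Lemma pow2S n : pow2 n.+1 = 2 * pow2 n.
Proof. by rewrite /pow2 Nat2Z.inj_succ Z.pow_succ_r //; apply: Nat2Z.is_nonneg. Qed.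

Lemma pow8S n : pow8 n.+1 = 8 * pow8 n.
Proof. by rewrite /pow8 Nat2Z.inj_succ Z.pow_succ_r //; apply: Nat2Z.is_nonneg. Qed.

(* Coefficients of the generating function (1 + 2 t) / (1 - 2 t - 8 x t^2). *)
Definition dist_ladder (n i : nat) : Z := pow2 (n + i) * lucas n i.
Definition dist7 (n i : nat) : Z :=
  pow8 i * lucas n i
  + shift 0 (fun j => pow2 (n + j) * lucas n j - pow8 j * lucas n j) i.

Lemma dist_ladder_rec n i :
  dist_ladder n.+2 i = 2 * dist_ladder n.+1 i + 8 * shift 0 (dist_ladder n) i.
Proof.
rewrite /dist_ladder /=; case: i => [|i] /=; rewrite ?addSn ?addnS !pow2S; ring.
Qed.

(** The terms with powers of 8 satisfy the homogeneous recurrence; the shifted [dist_ladder]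
    produces the last term, because the coefficient 2 in its own recurrence is 1 + 1. *)
Lemma dist7_rec n i :
  dist7 n.+2 i = dist7 n.+1 i + 8 * shift 0 (dist7 n) i + shift 0 (dist_ladder n.+1) i.
Proof.
rewrite /dist_ladder /dist7; case: i => [|[|i]] /=; rewrite ?addSn ?addnS ?pow2S ?pow8S; ring.
Qed.

Lemma lucas0 n : lucas n.+1 0 = 2.
Proof. by elim: n => //= n ->. Qed.

Definition count_movesZ s n i : Z := Z.of_nat (count_moves s n i).

Lemma of_nat_shift (f : nat -> nat) i :
  Z.of_nat (shift 0%N f i) = shift 0 (fun j => Z.of_nat (f j)) i.
Proof. by case: i. Qed.

Lemma count_movesZS s n i (l : seq (state * bool)) :
    [seq (next_state s mv, new_handle s mv) | mv <- all_moves] = l ->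
  count_movesZ s n.+1 i =
  foldr (fun p z => (if p.2 then shift 0 (count_movesZ p.1 n) i else count_movesZ p.1 n i) + z) 0 l.
Proof.
move=> l_moves; rewrite /count_movesZ (count_movesS _ _ l_moves) {l_moves}.
elim: l => [|[t b] l IHl] /=; first by rewrite big_nil.
by rewrite big_cons Nat2Z.inj_add IHl /=; case: b => //; rewrite of_nat_shift.
Qed.

Definition unit_at0 (i : nat) : Z := if i is 0%N then 1 else 0.

(** The pair [c3], [c5] is a closed subsystem, solved by [dist_ladder]. Then [c0] and [c4] coincide,
    and eliminating [c1] and [c2] gives [dist7_rec]. *)
Lemma recurrences7 (c0 c1 c2 c3 c4 c5 : nat -> nat -> Z) :
    (forall j, [/\ c0 0%N j = unit_at0 j, c1 0%N j = unit_at0 j & c2 0%N j = unit_at0 j]) ->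
    (forall j, [/\ c3 0%N j = unit_at0 j, c4 0%N j = unit_at0 j & c5 0%N j = unit_at0 j]) ->
    (forall m j, c0 m.+1 j = c2 m j + c0 m j + shift 0 (c3 m) j + shift 0 (c1 m) j) ->
    (forall m j, c1 m.+1 j = 2 * c4 m j + 2 * c0 m j) ->
    (forall m j, c2 m.+1 j = 2 * shift 0 (c0 m) j + 2 * shift 0 (c4 m) j) ->
    (forall m j, c3 m.+1 j = 2 * c5 m j + 2 * c3 m j) ->
    (forall m j, c4 m.+1 j = c2 m j + c4 m j + shift 0 (c3 m) j + shift 0 (c1 m) j) ->
    (forall m j, c5 m.+1 j = 4 * shift 0 (c3 m) j) ->
  forall n i, c0 n i = dist7 n i.
Proof.
move=> I0 I3 E0 E1 E2 E3 E4 E5.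
have L m : (forall j, c3 m j = dist_ladder m j) /\ forall j, c3 m.+1 j = dist_ladder m.+1 j.
  elim: m => [|m [IH0 IH1]].
    by split=> j; have [H3 H4 H5] := I3 j; rewrite ?E3 ?H3 ?H5 /dist_ladder;
      case: j {H3 H4 H5} => //= j; rewrite !Z.mul_0_r.
  split; first exact: IH1.
  move=> j; rewrite E3 E5 dist_ladder_rec IH1.
  by case: j => [|j] /=; rewrite ?IH0; ring.
have C m : (forall j, c0 m j = dist7 m j /\ c4 m j = dist7 m j) /\
           (forall j, c0 m.+1 j = dist7 m.+1 j /\ c4 m.+1 j = dist7 m.+1 j).
  elim: m => [|m [IH0 IH1]].
    split=> j; have [H0 H1 H2] := I0 j; have [H3 H4 H5] := I3 j.
      by rewrite H0 H4 /dist7; case: j {H0 H1 H2 H3 H4 H5} => [|[|j]] /=; rewrite ?Z.mul_0_r.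
    rewrite E0 E4 H0 H2 H4; case: j {H0 H1 H2 H3 H4 H5} => [|j] //=.
    have [_ -> _] := I0 j; have [-> _ _] := I3 j.
    by rewrite /dist7; case: j => [|j] /=; rewrite ?Z.mul_0_r.
  split; first exact: IH1.
  move=> j; rewrite E0 E4 E2 dist7_rec; have [-> ->] := IH1 j.
  case: j => [|j] /=; first by split; ring.
  have [_ ->] := L m; rewrite !E1; have [-> ->] := IH0 j; split; ring.
by move=> n i; have [/(_ i)[] ] := C n.
Qed.

Lemma count_moves7 n i : Z.of_nat (count_moves start7 n i) = dist7 n i.
Proof.
pose s1 : state := [:: (1, 3); (1, 2); (0, 1)]%N; pose s2 : state := [:: (2, 3)]%N.
pose s3 : state := [:: (0, 3); (0, 2); (0, 1)]%N; pose s4 : state := [:: (0, 3); (0, 2)]%N.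
pose s5 : state := [:: (2, 3); (0, 1)]%N.
rewrite -/(count_movesZ start7 n i).
apply: (@recurrences7 (count_movesZ start7) (count_movesZ s1) (count_movesZ s2)
  (count_movesZ s3) (count_movesZ s4) (count_movesZ s5)).
- by case.
- by case.
- move=> m j.
  rewrite (@count_movesZS start7 _ _
    [:: (s2, false); (start7, false); (s3, true); (s1, true)]) //=; lia.
- move=> m j.
  rewrite (@count_movesZS s1 _ _
    [:: (s4, false); (start7, false); (s4, false); (start7, false)]) //=; lia.
- move=> m j.
  rewrite (@count_movesZS s2 _ _
    [:: (start7, true); (start7, true); (s4, true); (s4, true)]) //=; lia.
- move=> m j.
  rewrite (@count_movesZS s3 _ _
    [:: (s5, false); (s3, false); (s3, false); (s5, false)]) //=; lia.
- move=> m j.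
  rewrite (@count_movesZS s4 _ _
    [:: (s1, true); (s3, true); (s4, false); (s2, false)]) //=; lia.
- move=> m j.
  rewrite (@count_movesZS s5 _ _
    [:: (s3, true); (s3, true); (s3, true); (s3, true)]) //=; lia.
Qed.

Lemma recurrences10 (c0 c1 c2 c3 c4 c5 : nat -> nat -> Z) :
    (forall j, [/\ c0 0%N j = unit_at0 j, c1 0%N j = unit_at0 j & c2 0%N j = unit_at0 j]) ->
    (forall j, [/\ c3 0%N j = unit_at0 j, c4 0%N j = unit_at0 j & c5 0%N j = unit_at0 j]) ->
    (forall m j, c0 m.+1 j =
       c0 m j + shift 0 (c1 m) j + shift 0 (c2 m) j + shift 0 (c3 m) j) ->
    (forall m j, c1 m.+1 j = 2 * c0 m j + 2 * shift 0 (c4 m) j) ->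
    (forall m j, c2 m.+1 j = 2 * c0 m j + 2 * shift 0 (c4 m) j) ->
    (forall m j, c3 m.+1 j = 2 * c3 m j + 2 * shift 0 (c5 m) j) ->
    (forall m j, c4 m.+1 j = c1 m j + c2 m j + c3 m j + c4 m j) ->
    (forall m j, c5 m.+1 j = 4 * c3 m j) ->
  forall n i,
    4 * c0 n i = dist7 n.+1 i + (match i with 0%N => 2 | 1%N => -2 | _ => 0 end).
Proof.
move=> I0 I3 E0 E1 E2 E3 E4 E5.
have L m : forall j, 4 * c3 m j = dist_ladder m.+1 j /\ c5 m j = dist_ladder m j.
  elim: m => [|m IH] j.
    by have [-> H4 ->] := I3 j; rewrite /dist_ladder; case: j {H4} => //= j; rewrite !Z.mul_0_r.
  rewrite E3 E5 dist_ladder_rec; have [<- _] := IH j.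
  split; last by ring.
  case: j => [|j] /=; first by ring.
  by have [_ ->] := IH j; ring.
have C : forall m j,
  [/\ 4 * c0 m j =
        dist7 m.+1 j + (match j with 0%N => 2 | 1%N => -2 | _ => 0 end),
      c1 m j = dist7 m j, c2 m j = dist7 m j &
      4 * c4 m j = dist7 m.+1 j.+1 + (match j with 0%N => 2 | _ => 0 end)].
  elim=> [|m IH] j.
    have [-> -> ->] := I0 j; have [H3 -> H5] := I3 j.
    by rewrite /dist7; case: j {H3 H5} => [|[|j]] /=; rewrite ?Z.mul_0_r.
  have B0 : dist7 m.+1 0 = 2 by rewrite /dist7 lucas0.
  have [H0 H1 H2 H4] := IH j; have [L3 L5] := L m j.
  split.
  - rewrite E0 dist7_rec; case: j {H1 H2 H4 L3 L5} H0 => [|j] H0; first by rewrite /=; lia.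
    have [_ G1 G2 _] := IH j; have [G3 _] := L m j.
    by rewrite /= G1 G2 -G3; case: j H0 {G1 G2 G3} => [|j] /=; lia.
  - rewrite E1; case: j {H1 H2 H4 L3 L5} H0 => [|j] H0; rewrite /=; first by lia.
    by have [_ _ _] := IH j; case: j H0 => [|j] /=; lia.
  - rewrite E2; case: j {H1 H2 H4 L3 L5} H0 => [|j] H0; rewrite /=; first by lia.
    by have [_ _ _] := IH j; case: j H0 => [|j] /=; lia.
  - by rewrite E4 dist7_rec /= H1 H2 -L3; lia.
by move=> n i; have [] := C n i.
Qed.

Lemma count_moves10 n i :
  4 * Z.of_nat (count_moves start10 n i) =
  dist7 n.+1 i + (match i with 0%N => 2 | 1%N => -2 | _ => 0 end).
Proof.
pose s1 : state := [:: (1, 3); (0, 1)]%N; pose s2 : state := [:: (2, 3); (0, 2)]%N.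
pose s3 : state := [:: (0, 3); (1, 2)]%N; pose s4 : state := [:: (1, 3); (0, 2); (0, 1)]%N.
pose s5 : state := [:: (2, 3); (1, 2); (0, 1)]%N.
rewrite -/(count_movesZ start10 n i).
apply: (@recurrences10 (count_movesZ start10) (count_movesZ s1) (count_movesZ s2)
  (count_movesZ s3) (count_movesZ s4) (count_movesZ s5)).
- by case.
- by case.
- move=> m j.
  rewrite (@count_movesZS start10 _ _
    [:: (s1, true); (s3, true); (start10, false); (s2, true)]) //=; lia.
- move=> m j.
  rewrite (@count_movesZS s1 _ _
    [:: (start10, false); (s4, true); (start10, false); (s4, true)]) //=; lia.
- move=> m j.
  rewrite (@count_movesZS s2 _ _
    [:: (s4, true); (s4, true); (start10, false); (start10, false)]) //=; lia.
- move=> m j.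
  rewrite (@count_movesZS s3 _ _
    [:: (s5, true); (s3, false); (s3, false); (s5, true)]) //=; lia.
- move=> m j.
  rewrite (@count_movesZS s4 _ _
    [:: (s2, false); (s4, false); (s3, false); (s1, false)]) //=; lia.
- move=> m j.
  rewrite (@count_movesZS s5 _ _
    [:: (s3, false); (s3, false); (s3, false); (s3, false)]) //=; lia.
Qed.

(** * Binomial form, support and ratios of the Lucas coefficients *)

Lemma lucas_bin n i : lucas n.+1 i = Z.of_nat ('C(n.+1 - i, i) + 'C(n - i, i)).
Proof.
suff H : (forall i, lucas n.+1 i = Z.of_nat ('C(n.+1 - i, i) + 'C(n - i, i))) /\
         (forall i, lucas n.+2 i = Z.of_nat ('C(n.+2 - i, i) + 'C(n.+1 - i, i))).
  by case: H.
elim: n => [|n [IH0 IH1]] {i}.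
  by split=> [[|[|i]]|[|[|[|i]]]] //=; rewrite ?subSS ?sub0n ?bin0n.
split; first exact: IH1.
move=> [|i]; first by rewrite lucas0 !subn0 !bin0.
rewrite -[lucas n.+3 i.+1]/(lucas n.+2 i.+1 + lucas n.+1 i) IH0 IH1 !subSS -Nat2Z.inj_add.
congr Z.of_nat; case: (leqP i n) => ni.
  by rewrite !subSn // ?binS; [lia | exact: leq_trans ni _].
by rewrite !bin_small //; lia.
Qed.

Lemma lucas_out n i : (n < i.*2)%N -> lucas n i = 0.
Proof. by case: n => [|n] ni; [case: i ni | rewrite lucas_bin !bin_small //; lia]. Qed.

Lemma lucas_gt0 n i : (i.*2 <= n)%N -> 0 < lucas n i.
Proof.
case: n => [|n] ni; first by case: i ni.
rewrite lucas_bin; have : (0 < 'C(n.+1 - i, i))%N by rewrite bin_gt0; lia.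
lia.
Qed.

Lemma lucas_ge0 n i : 0 <= lucas n i.
Proof. by case: n => [|n]; [case: i | rewrite lucas_bin; apply: Nat2Z.is_nonneg]. Qed.

(** The linear factors come from A_n(i) = (2n - 3i)/(n - i) C(n - i, i): with n = x + 2y + 2, the
    number 2n - 3i is 2x + y + 4 for i = y and 2x + y + 1 for i = y + 1. *)
Lemma lucas_ratio m j (x := Z.of_nat m) (y := Z.of_nat j) (n := (m + j.+1.*2)%N) :
  (y + 1) * (x + y + 1) * (2 * x + y + 4) * lucas n j.+1 =
  (x + 1) * (x + 2) * (2 * x + y + 1) * lucas n j.
Proof.
have -> : n = (m + j + j.+1).+1 by rewrite /n; lia.
rewrite !lucas_bin; set N := (m + j).+1.
have -> : ((m + j + j.+1).+1 - j.+1 = N)%N by rewrite /N; lia.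
have -> : (m + j + j.+1 - j.+1 = N.-1)%N by rewrite /N; lia.
have -> : ((m + j + j.+1).+1 - j = N.+1)%N by rewrite /N; lia.
have -> : (m + j + j.+1 - j = N)%N by rewrite /N; lia.
have := mul_bin_left N j; have := mul_bin_down N j.+1; have := mul_bin_down N.+1 j.
have -> : (N - j = m.+1)%N by rewrite /N; lia.
have -> : (N - j.+1 = m)%N by rewrite /N; lia.
have -> : (N.+1 - j = m.+2)%N by rewrite /N; lia.
have NE : Z.of_nat N = x + y + 1 by rewrite /N; lia.
rewrite /=; move: 'C(N.+1, j) 'C(N.-1, j.+1) 'C(N, j.+1) 'C(N, j) => z v w c Hz Hv Hw.
have {}Hz : (x + y + 2) * Z.of_nat c = (x + 2) * Z.of_nat z by rewrite /x /y; lia.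
have {}Hv : (x + y + 1) * Z.of_nat v = x * Z.of_nat w by rewrite /x /y; lia.
have {}Hw : (y + 1) * Z.of_nat w = (x + 1) * Z.of_nat c by rewrite /x /y; lia.
rewrite !Nat2Z.inj_add.
have -> : (y + 1) * (x + y + 1) * (2 * x + y + 4) * (Z.of_nat w + Z.of_nat v) =
          (2 * x + y + 4) * (2 * x + y + 1) * ((y + 1) * Z.of_nat w).
  transitivity ((2 * x + y + 4) * (y + 1) *
    ((x + y + 1) * Z.of_nat w + (x + y + 1) * Z.of_nat v)); first by ring.
  by rewrite Hv; ring.
transitivity ((x + 1) * (2 * x + y + 1) * ((x + 2) * Z.of_nat z + (x + 2) * Z.of_nat c)).
  by rewrite -Hz Hw; ring.
ring.
Qed.

(** * Comparison of consecutive values *)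

Lemma pow2_gt0 n : 0 < pow2 n.
Proof. by apply: Z.pow_pos_nonneg => //; apply: Nat2Z.is_nonneg. Qed.

Lemma pow8_gt0 n : 0 < pow8 n.
Proof. by apply: Z.pow_pos_nonneg => //; apply: Nat2Z.is_nonneg. Qed.

(** Since n + j = m + 2 + 3j, the factor 8^j splits off. With W = 2^(m+2) and u, v, w the values of
    A_n at j, j+1, j+2, it remains to compare (W - 1)u + 8v with (2W - 8)v + 64w. *)
Lemma dist7E m j (n := (m + j.+1.*2)%N) :
  dist7 n j.+1 = pow8 j * ((pow2 m.+2 - 1) * lucas n j + 8 * lucas n j.+1) /\
  dist7 n j.+2 =
    pow8 j * ((2 * pow2 m.+2 - 8) * lucas n j.+1 + 64 * lucas n j.+2).
Proof.
have E : pow2 (n + j) = pow8 j * pow2 m.+2.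
  have -> : (n + j = m.+2 + 3 * j)%N by rewrite /n; lia.
  elim: j {n} => [|j IHj]; first by rewrite addn0 /pow8 Z.mul_1_l.
  have -> : (m.+2 + 3 * j.+1 = (m.+2 + 3 * j).+3)%N by lia.
  by rewrite 3!pow2S IHj pow8S; ring.
by clearbody n; move: (pow2 m.+2) E => W E; rewrite /dist7 /shift addnS pow2S !pow8S E; split; ring.
Qed.

Lemma ratio_le P Q a b c d : P * b = Q * a -> 0 < P -> 0 <= a -> d * Q <= c * P ->
  d * b <= c * a.
Proof.
move=> E P0 a0 cd; apply: (proj2 (Z.mul_le_mono_pos_l _ _ P P0)).
have -> : P * (d * b) = d * Q * a by rewrite -Z.mul_assoc -E; ring.
have -> : P * (c * a) = c * P * a by ring.
exact: Z.mul_le_mono_nonneg_r.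
Qed.

Lemma ratio_ge P Q a b c d : P * b = Q * a -> 0 < P -> 0 <= a -> c * P <= d * Q ->
  c * a <= d * b.
Proof.
move=> E P0 a0 cd; apply: (proj2 (Z.mul_le_mono_pos_l _ _ P P0)).
have -> : P * (d * b) = d * Q * a by rewrite -Z.mul_assoc -E; ring.
have -> : P * (c * a) = c * P * a by ring.
exact: Z.mul_le_mono_nonneg_r.
Qed.

Lemma rise_ineq x y : 0 <= y <= x -> (y + 1) * (x + y + 1) * (2 * x + y + 4) <=
  2 * ((x + 1) * (x + 2) * (2 * x + y + 1)).
Proof.
move=> [y0 yx]; have [t [-> t0]] : exists t, x = y + t /\ 0 <= t by exists (x - y); lia.
nia.
Qed.

Lemma rise_next_ineq x y : 0 <= y <= x -> 7 <= x ->
  (y + 2) * (x + y) * (2 * x + y + 1) <= 4 * ((x - 1) * x * (2 * x + y - 2)).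
Proof.
move=> [y0 yx] x7.
have [t [xt t0]] : exists t, x = 7 + t /\ 0 <= t by exists (x - 7); lia.
have [u [yu u0]] : exists u, y = x - u /\ 0 <= u by exists (x - y); lia.
nia.
Qed.

(** The hypothesis compares the quadratic factors, and 2x + y + 1 is below 2x + y + 4. *)
Lemma fall_quarter_ineq x y : 0 <= x -> 0 <= y ->
    4 * ((x + 1) * (x + 2)) <= (y + 1) * (x + y + 1) ->
  4 * ((x + 1) * (x + 2) * (2 * x + y + 1)) <= (y + 1) * (x + y + 1) * (2 * x + y + 4).
Proof. by move=> x0 y0 H; nia. Qed.

Lemma fall_quarter_next_ineq x y : x + 1 <= y -> 2 <= x ->
    4 * ((x + 1) * (x + 2)) <= (y + 1) * (x + y + 1) ->
  4 * ((x - 1) * x * (2 * x + y - 2)) <= (y + 2) * (x + y) * (2 * x + y + 1).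
Proof.
move=> xy x2 H; have : 4 * ((x - 1) * x) <= (y + 2) * (x + y) by nia.
by nia.
Qed.

(** The coefficients make this an equality at y = x + 1. *)
Lemma fall_gap_ineq x y : 0 <= x -> x + 1 <= y ->
  (6 * x + 10) * ((x + 1) * (x + 2) * (2 * x + y + 1)) <=
  (3 * x + 2) * ((y + 1) * (x + y + 1) * (2 * x + y + 4)).
Proof.
move=> x0 xy; have [t [-> t0]] : exists t, y = x + 1 + t /\ 0 <= t by exists (y - x - 1); lia.
nia.
Qed.

Lemma fall_half_next_ineq x y : x + 1 <= y -> 2 <= x ->
  2 * ((x - 1) * x * (2 * x + y - 2)) <= (y + 2) * (x + y) * (2 * x + y + 1).
Proof.
move=> xy x2; have : 2 * ((x - 1) * x) <= (y + 2) * (x + y) by nia.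
by nia.
Qed.

Lemma pow2_ge m : (4 <= m)%N -> 9 * Z.of_nat m + 16 <= pow2 m.+2.
Proof.
move=> m4; have -> : m = (m - 4 + 4)%N by lia.
elim: (m - 4)%N => [|k IHk] //; rewrite addSn pow2S; lia.
Qed.

Lemma lucas_ratio_next m j (x := Z.of_nat m) (y := Z.of_nat j) (n := (m + j.+1.*2)%N) :
  (2 <= m)%N ->
  (y + 2) * (x + y) * (2 * x + y + 1) * lucas n j.+2 =
  (x - 1) * x * (2 * x + y - 2) * lucas n j.+1.
Proof.
move=> m2; have := lucas_ratio (m - 2) j.+1.
have -> : (m - 2 + j.+2.*2 = n)%N by rewrite /n; lia.
have -> : Z.of_nat (m - 2) = x - 2 by rewrite /x; lia.
have -> : Z.of_nat j.+1 = y + 1 by rewrite /y; lia.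
clearbody n x y => /= E.
transitivity ((y + 1 + 1) * (x - 2 + (y + 1) + 1) * (2 * (x - 2) + (y + 1) + 4) * lucas n j.+2).
  by ring.
by rewrite E; ring.
Qed.

(** Up to the factor 8^j, the increment is W(2v - u) + u + 16(4w - v), positive as soon as u <= 2v
    and v <= 4w. *)
Lemma dist7_increase m j (n := (m + j.+1.*2)%N) : (j <= m)%N -> (7 <= m)%N ->
  dist7 n j.+1 < dist7 n j.+2.
Proof.
move=> jm m7; have [-> ->] := dist7E m j; rewrite -/n.
apply: (proj1 (Z.mul_lt_mono_pos_l _ _ _ (pow8_gt0 j))).
have a0 : 0 < lucas n j by apply: lucas_gt0; rewrite /n; lia.
have a1 : 0 < lucas n j.+1 by apply: lucas_gt0; rewrite /n; lia.
have yx : 0 <= Z.of_nat j <= Z.of_nat m by lia.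
have x7 : 7 <= Z.of_nat m by lia.
have H1 := ratio_ge (lucas_ratio m j).
have {}H1 : 1 * lucas n j <= 2 * lucas n j.+1.
  apply: H1; [by do !apply: Z.mul_pos_pos; lia | exact: lucas_ge0 |].
  have := rise_ineq yx; lia.
have H2 := ratio_ge (@lucas_ratio_next m j _).
have {}H2 : 1 * lucas n j.+1 <= 4 * lucas n j.+2.
  apply: H2; [lia | by do !apply: Z.mul_pos_pos; lia | exact: lucas_ge0 |].
  have := rise_next_ineq yx x7; lia.
have := pow2_gt0 m.+2; move: (pow2 _) (lucas n j) (lucas n j.+1) (lucas n j.+2) a0 a1 H1 H2.
move=> W u v w u0 v0 uv vw W0; have : 0 <= W * (2 * v - u) by apply: Z.mul_nonneg_nonneg; lia.
lia.
Qed.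

(** Up to the factor 8^j, the drop is W(u - 2v) - u + 16(v - 4w); upper bounds for v/u and w/v keep
    it positive. *)
Lemma dist7_decrease m j (n := (m + j.+1.*2)%N) : (m < j)%N -> (22 <= n)%N ->
  dist7 n j.+2 < dist7 n j.+1.
Proof.
move=> mj n22; have [-> ->] := dist7E m j; rewrite -/n.
apply: (proj1 (Z.mul_lt_mono_pos_l _ _ _ (pow8_gt0 j))).
have a0 : 0 < lucas n j by apply: lucas_gt0; rewrite /n; lia.
have a1 : 0 < lucas n j.+1 by apply: lucas_gt0; rewrite /n; lia.
have a2 : 0 <= lucas n j.+2 by exact: lucas_ge0.
have x0 : 0 <= Z.of_nat m by lia.
have xy : Z.of_nat m + 1 <= Z.of_nat j by lia.
have W4 : 4 <= pow2 m.+2 by rewrite !pow2S; have := pow2_gt0 m; lia.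
have R1 := ratio_le (lucas_ratio m j); have R2 := ratio_le (@lucas_ratio_next m j _).
have [m1 | m2] := leqP m 1.
  have z2 : lucas n j.+2 = 0 by apply: lucas_out; rewrite /n; lia.
  have H1 : 4 * lucas n j.+1 <= 1 * lucas n j.
    apply: R1; [by do !apply: Z.mul_pos_pos; lia | exact: lucas_ge0 |].
    have := @fall_quarter_ineq (Z.of_nat m) (Z.of_nat j) x0; nia.
  nia.
have x2 : 2 <= Z.of_nat m by lia.
(* Either a1 / a0 is at most 1/4, or n < 5 m + 8 and the factor 2^(m+2) makes up for the
   small gap 1 - 2 a1 / a0 >= 3 / (3 m + 5), where a0 = A_n(j) and a1 = A_n(j+1). *)
have [small | large] := Z.le_gt_cases (4 * ((Z.of_nat m + 1) * (Z.of_nat m + 2)))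
  ((Z.of_nat j + 1) * (Z.of_nat m + Z.of_nat j + 1)).
  have H1 : 4 * lucas n j.+1 <= 1 * lucas n j.
    apply: R1; [by do !apply: Z.mul_pos_pos; lia | exact: lucas_ge0 |].
    have := @fall_quarter_ineq (Z.of_nat m) (Z.of_nat j) x0; lia.
  have H2 : 4 * lucas n j.+2 <= 1 * lucas n j.+1.
    apply: R2; [lia | by do !apply: Z.mul_pos_pos; lia | exact: lucas_ge0 |].
    have := fall_quarter_next_ineq xy x2 small; lia.
  move: (pow2 _) (lucas n j) (lucas n j.+1) (lucas n j.+2) a0 a1 a2 H1 H2 W4.
  move=> W u v w u0 v0 w0 H1 H2 W4.
  have : (W - 1) * (4 * v) <= (W - 1) * u by apply: Z.mul_le_mono_nonneg_l; lia.
  have : 4 * v <= W * v by apply: Z.mul_le_mono_nonneg_r; lia.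
  lia.
have H1 : (6 * Z.of_nat m + 10) * lucas n j.+1 <= (3 * Z.of_nat m + 2) * lucas n j.
  apply: R1; [by do !apply: Z.mul_pos_pos; lia | exact: lucas_ge0 |].
  have := fall_gap_ineq x0 xy; lia.
have H2 : 2 * lucas n j.+2 <= 1 * lucas n j.+1.
  apply: R2; [lia | by do !apply: Z.mul_pos_pos; lia | exact: lucas_ge0 |].
  have := fall_half_next_ineq xy x2; lia.
have m4 : (4 <= m)%N.
  have : Z.of_nat j + 1 < 2 * (Z.of_nat m + 2) by nia.
  rewrite /n in n22; lia.
have := pow2_ge m4; move: (pow2 _) (lucas n j) (lucas n j.+1) (lucas n j.+2) a0 a1 a2 H1 H2 W4.
move: (Z.of_nat m) x0 x2 => x x0 x2 W u v w u0 v0 w0 H1 H2 W4 W9.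
(* With 2w <= v the negative part is at most u + 16v < 9u <= (9x + 15)(u - 2v), below W(u - 2v) by
   the bound on W. *)
have gap : 3 * u <= (3 * x + 5) * (u - 2 * v) by lia.
have uv : 0 < u - 2 * v by nia.
have : (9 * x + 16) * (u - 2 * v) <= W * (u - 2 * v) by apply: Z.mul_le_mono_nonneg_r; lia.
lia.
Qed.

(** * Location of the single peak *)

Lemma dist7_out n i : (n < i.*2)%N -> dist7 n i.+1 = 0.
Proof.
move=> ni; rewrite /dist7 /shift !lucas_out ?doubleS; [by rewrite !Z.mul_0_r | done | lia].
Qed.

(** The tail decreases only weakly, because the closed forms vanish beyond the maximal genus. *)
Definition single_peak (g : nat -> Z) (p : nat) : Prop :=
  [/\ forall i, (i < p)%N -> g i < g i.+1, g p.+1 < g p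
    & forall i, (p < i)%N -> g i.+1 <= g i].

Definition check_peak (g : nat -> Z) (p n : nat) : bool :=
  [&& all (fun i => Z.ltb (g i) (g i.+1)) (iota 0 p), Z.ltb (g p.+1) (g p)
    & all (fun i => Z.leb (g i.+1) (g i)) (iota p.+1 n)].

Lemma check_peakP g p n : (forall i, 0 <= g i) -> (forall i, (n < i)%N -> g i.+1 = 0) ->
  check_peak g p n -> single_peak g p.
Proof.
move=> g0 gn /and3P[/allP up top /allP down]; split=> [i ip||i pi].
- by apply/Z.ltb_lt/up; rewrite mem_iota.
- exact/Z.ltb_lt.
- have [ni | ni] := ltnP n i; first by rewrite gn.
  by apply/Z.leb_le/down; rewrite mem_iota pi; lia.
Qed.

Lemma dist7_ge0 n i : 0 <= dist7 n i.
Proof. by rewrite -count_moves7; apply: Nat2Z.is_nonneg. Qed.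

Lemma dist7_0 n : dist7 n.+1 0 = 2.
Proof. by rewrite /dist7 lucas0. Qed.

(** The step from genus 0 is not covered by [dist7E]. The bound 8 also leaves room for the
    corrections in [dist10], as 2 + 2 < 8 - 2. *)
Lemma dist7_1 n : (4 <= n)%N -> 8 <= dist7 n 1.
Proof.
move=> n4; have -> : n = (n - 2 + 1.*2)%N by lia.
have [-> _] := dist7E (n - 2) 0; set k := (n - 2)%N.
have -> : lucas (k + 1.*2)%N 0 = 2 by rewrite addnS lucas0.
have := @lucas_ge0 (k + 1.*2)%N 1; rewrite /pow8 Z.mul_1_l.
have -> : k = (k - 2).+2 by lia.
by rewrite !pow2S; have := pow2_gt0 (k - 2)%N; lia.
Qed.

(** For i = j + 1 and m = n - 2i, the bound 3i <= n + 1 says j <= m, and n >= 22 then gives m >=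
    7. *)
Lemma dist7_up n i : (22 <= n)%N -> (0 < i)%N -> (3 * i <= n + 1)%N ->
  dist7 n i < dist7 n i.+1.
Proof.
case: i => // j n22 _ i3; have -> : n = (n - j.+1.*2 + j.+1.*2)%N by lia.
by apply: dist7_increase; lia.
Qed.

Lemma dist7_down n i : (22 <= n)%N -> (n + 2 <= 3 * i)%N -> (i.*2 <= n)%N ->
  dist7 n i.+1 < dist7 n i.
Proof.
case: i => [|j] n22 i3 i2; first lia.
have nE : n = (n - j.+1.*2 + j.+1.*2)%N by lia.
rewrite nE; apply: dist7_decrease; lia.
Qed.

Definition peak7 (n : nat) : nat :=
  (if n <= 7 then n %/ 2 else if n == 8 then 3 else (n + 1) %/ 3 + 1)%N.

Definition peak10 (n : nat) : nat :=
  (if n <= 6 then (n + 1) %/ 2 else if n == 7 then 3 else (n + 2) %/ 3 + 1)%N.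

Lemma check_peak7 : all (fun n => check_peak (dist7 n) (peak7 n) n) (iota 2 20).
Proof. by vm_compute. Qed.

Lemma single_peak7 n : (2 <= n)%N -> single_peak (dist7 n) (peak7 n).
Proof.
move=> n2; have [n22 | n21] := leqP 22 n.
  have -> : peak7 n = ((n + 1) %/ 3 + 1)%N by rewrite /peak7; repeat case: ifP; lia.
  split=> [i ip||i pi].
  - case: i ip => [|i] ip; last by apply: dist7_up; lia.
    have -> : dist7 n 0 = 2 by rewrite -(ltn_predK n2) dist7_0.
    by have := @dist7_1 n; lia.
  - by apply: dist7_down; lia.
  - have [i2 | i2] := leqP i.*2 n; first by apply/Z.lt_le_incl/dist7_down; lia.
    by rewrite dist7_out //; apply: dist7_ge0.
apply: (check_peakP (n := n)); [exact: dist7_ge0 | by move=> i ni; apply: dist7_out; lia |].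
have n_small : n \in iota 2 20 by rewrite mem_iota n2.
exact: (allP check_peak7 n n_small).
Qed.

Definition dist10 (n i : nat) : Z :=
  dist7 n.+1 i + (match i with 0%N => 2 | 1%N => -2 | _ => 0 end).

Lemma check_peak10 : all (fun n => check_peak (dist10 n) (peak10 n) n.+1) (iota 1 20).
Proof. by vm_compute. Qed.

Lemma single_peak10 n : (1 <= n)%N -> single_peak (dist10 n) (peak10 n).
Proof.
move=> n1; have [n21 | n20] := leqP 21 n.
  have -> : peak10 n = ((n + 2) %/ 3 + 1)%N by rewrite /peak10; repeat case: ifP; lia.
  split=> [i ip||i pi].
  - rewrite /dist10; case: i ip => [|[|i]] ip.
    + by rewrite dist7_0; have := @dist7_1 n.+1; lia.
    + by have := @dist7_up n.+1 1; lia.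
    + by have := @dist7_up n.+1 i.+2; lia.
  - rewrite /dist10; case E : (_ + 1)%N => [|[|p]]; [lia | lia |].
    by have := @dist7_down n.+1 p.+2; lia.
  - rewrite /dist10; case: i pi => [|[|i]] pi; [lia | lia |].
    have [i2 | i2] := leqP i.+2.*2 n.+1; first by have := @dist7_down n.+1 i.+2; lia.
    by have := @dist7_out n.+1 i.+2; have := @dist7_ge0 n.+1 i.+2; lia.
apply: (check_peakP (n := n.+1)).
- by move=> i; rewrite /dist10 -count_moves10; lia.
- by move=> [|i] ni //; rewrite /dist10 dist7_out; [|lia].
have n_small : n \in iota 1 20 by rewrite mem_iota n1.
exact: (allP check_peak10 n n_small).
Qed.

Local Close Scope Z_scope.
Local Open Scope nat_scope.

(** * From closed forms to genus distributions *)

Section Distribution.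
Variables (n : nat) (S : ladder_family n).

Lemma genus_in_range i : 0 < genus_dist S i -> min_genus S <= i <= max_genus S.
Proof.
rewrite card_gt0 => /set0Pn[KT]; rewrite inE => /eqP <-; apply/andP; split.
  by rewrite /min_genus; case: arg_minnP => // x _; apply.
by rewrite /max_genus; case: arg_maxnP => // x _; apply.
Qed.

(** The factor [c] is 1 for the seventh family and 4 for the tenth. The peak lies in the genus range
    because its count exceeds the next one and is therefore positive. *)
Lemma peak_genus (g : nat -> Z) (c : Z) p : Z.lt Z0 c -> (forall i, Z.le Z0 (g i)) ->
  (forall i, Z.mul c (Z.of_nat (genus_dist S i)) = g i) ->
  single_peak g p -> peak_genus_dist S p.
Proof.
move=> c0 g0 gE [up top down].
have lt i j : Z.lt (g i) (g j) -> genus_dist S i < genus_dist S j by rewrite -!gE; nia.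
have le i j : Z.le (g i) (g j) -> genus_dist S i <= genus_dist S j by rewrite -!gE; nia.
have /andP[minp maxp] : min_genus S <= p <= max_genus S.
  by apply: genus_in_range; apply: leq_ltn_trans (lt _ _ top).
rewrite /peak_genus_dist /is_peak /unimodal_at minp leqnn; split=> //; split=> //.
split=> [i _ ip|]; first by apply/ltnW/lt/up/ltnW.
split=> [minp'|]; first by apply: lt; case: p minp' up {top down minp maxp} => // p _; apply.
split=> [i|]; first by rewrite -eqn_leq => /eqP ->.
by split=> [_|i pi _]; [apply: lt | apply/le/down].
Qed.
End Distribution.

Lemma peak7P n : 2 <= n -> peak_genus_dist (@S7 n) (peak7 n).
Proof.
move=> n2; apply: (@peak_genus _ _ (dist7 n) (Z.of_nat 1)) (single_peak7 n2) => // i.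
- exact: dist7_ge0.
- by rewrite genus_dist_S7 ?count_moves7 ?Z.mul_1_l //; lia.
Qed.

Lemma peak10P n : 1 <= n -> peak_genus_dist (@S10 n) (peak10 n).
Proof.
move=> n1; apply: (@peak_genus _ _ (dist10 n) (Z.of_nat 4)) (single_peak10 n1) => // i.
- by rewrite /dist10 -count_moves10; lia.
- by rewrite genus_dist_S10 ?count_moves10.
Qed.

(** Genera 0 and 1 both occur twice, so there is a plateau from 0 to 1 instead of a peak. *)
Lemma unimodal7_1 : unimodal_genus_dist (@S7 1).
Proof.
have E i : Z.of_nat (genus_dist (@S7 1) i) = dist7 1 i by rewrite genus_dist_S7 ?count_moves7.
have E0 : genus_dist (@S7 1) 0 = 2 by have := E 0; rewrite dist7_0; lia.
have E1 : genus_dist (@S7 1) 1 = 2.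
  by have := E 1; rewrite (_ : dist7 1 1 = Z.of_nat 2) //; lia.
have E2 i : genus_dist (@S7 1) i.+2 = 0.
  by have := E i.+2; rewrite dist7_out //; lia.
exists 0, 1; have /andP[q0 _] : min_genus (@S7 1) <= 0 <= max_genus (@S7 1).
  by apply: genus_in_range; rewrite E0.
have /andP[_ r1] : min_genus (@S7 1) <= 1 <= max_genus (@S7 1).
  by apply: genus_in_range; rewrite E1.
rewrite /unimodal_at q0; split=> //; split=> //; split=> //; split=> //.
split; first by move=> [|[|i]]; rewrite ?E0 ?E1.
by split=> [_|[|i] // _ _]; rewrite E2 ?E1.
Qed.

Theorem corollary3p10 :
  forall n : nat, 1 <= n ->
    (unimodal_genus_dist (@S7 n) /\
     (2 <= n <= 7 -> peak_genus_dist (@S7 n) (n %/ 2)) /\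
     (n = 8 -> peak_genus_dist (@S7 n) 3) /\
     (9 <= n -> peak_genus_dist (@S7 n) ((n + 1) %/ 3 + 1)))
    /\
    (unimodal_genus_dist (@S10 n) /\
     (1 <= n <= 6 -> peak_genus_dist (@S10 n) ((n + 1) %/ 2)) /\
     (n = 7 -> peak_genus_dist (@S10 n) 3) /\
     (8 <= n -> peak_genus_dist (@S10 n) ((n + 2) %/ 3 + 1))).
Proof.
move=> n n1; split; split.
- have [n2|n2] := leqP 2 n; first by exists (peak7 n), (peak7 n); apply: peak7P.
  have -> : n = 1 by lia.
  exact: unimodal7_1.
- have p7 k : 2 <= n -> peak7 n = k -> peak_genus_dist (@S7 n) k.
    by move=> n2 <-; apply: peak7P.
  by split; [|split]; move=> H; (apply: p7; first lia); rewrite /peak7; repeat case: ifP; lia.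
- by exists (peak10 n), (peak10 n); apply: peak10P.
- have p10 k : peak10 n = k -> peak_genus_dist (@S10 n) k.
    by move=> <-; apply: peak10P.
  by split; [|split]; move=> H; apply: p10; rewrite /peak10; repeat case: ifP; lia.
Qed.
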